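(* Let $\{a_n\}_{n\in\mathbb{N}}$ be a sequence in $(0,1)$ with $a_n\nearrow1$, and let $\{\pi^m_n\}_{m,n\in\mathbb{N}}$ be an array of probability measures on $(0,\infty)$. For $\tau>0$ set $m_n(\tau)=\lceil\tau(1-a_n)^{-1}\rceil$ and let $$\rho_n:=(1-a_n)\Big(\delta_0+\sum_{k=1}^\infty (a_n)^k(\pi^1_n*\dots*\pi^k_n)\Big).$$ Consider the following conditions. (A) There exists an infinitely divisible probability measure $\nu$ on $[0,\infty)$ with $\nu(\{0\})=0$ such that $\pi^1_n*\dots*\pi^{m_n(\tau)}_n\to\nu^\tau$ weakly as $n\to\infty$, for all $\tau>0$. (B1) There exists a probability measure $\rho$ on $[0,\infty)$ with $\rho(\{0\})=0$ such that $\rho_n\to\rho$ weakly. (B2) There exists a probability measure $\nu$ on $[0,\infty)$ with $\nu(\{0\})=0$ such that $\pi^1_n*\dots*\pi_n^{\lceil 1/(1-a_n)\rceil}\to\nu$ weakly. (C) $\lim_{n\to\infty}\sup_{m\le m_n(\tau)}\pi^m_n[\delta,\infty)=0$ for all $\tau,\delta>0$, and there exists a sequence $\{d_n\}$ in $\mathbb{N}$ such that $(1-a_n)d_n\to0$ and $$\lim_{n\to\infty}\sum_{m=1}^{m_n(\tau)}d_{FM}\big(\pi^m_n,\pi_n^{m\,(\mathrm{mod}\ d_n)}\big)=0\quad\text{for all }\tau>0.$$ Then (B1) together with (C) implies (A), and (B2) together with (C) implies (A). Moreover, the probability measure $\rho$ of (B1) and $\nu$ of (A) are related by $\hat\rh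o=(1-\log\hat\nu)^{-1}$.
   Context: $\hat\kappa(\lambda)=\int_{[0,\infty)} e^{-\lambda t}\kappa(dt)$ is the Laplace transform; $\nu^\tau$ is the $\tau$-th convolution power of an infinitely divisible $\nu$, $\widehat{\nu^\tau}=(\hat\nu)^\tau$. $d_{FM}$ is the Fortet–Mourier metric on probability measures on $[0,\infty)$: $d_{FM}(\nu_1,\nu_2)=\sup_f|\int f\,d\nu_1-\int f\,d\nu_2|$, the supremum being over all $[-1,1]$-valued $1$-Lipschitz functions on $[0,\infty)$. $m\,(\mathrm{mod}\ d_n)$ denotes the remainder of $m$ after division by $d_n$, taken in $\{1,\dots,d_n\}$. *)

(* Defs.v *)
From HB Require Import structures.
From mathcomp Require Import all_boot all_order all_algebra.
From mathcomp Require Import all_classical all_reals all_analysis.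
From mathcomp Require Import measurable_realfun.

Set Implicit Arguments.
Unset Strict Implicit.
Unset Printing Implicit Defensive.

Import Order.TTheory GRing.Theory Num.Theory.
Import numFieldNormedType.Exports.

Local Open Scope classical_set_scope.
Local Open Scope ring_scope.

(* A probability measure on [0, oo) (resp. (0, oo)) is encoded as a Borel
   probability measure on the real line giving mass 1 to that half-line. Test
   functions are accordingly constrained on [0, oo) only, and integrals are
   taken over [0, oo). *)
Notation rprob R := (probability R R).

Definition on_nonneg (R : realType) (mu : rprob R) : Prop :=
  mu `[0%R, +oo[%classic = 1%E.

Definition on_pos (R : realType) (mu : rprob R) : Prop :=
  mu `]0%R, +oo[%classic = 1%E.

Section convolution.
Variable R : realType.

Definition add_pair (z : R * R) : R := z.1 + z.2.

Lemma measurable_add_pair : measurable_fun setT add_pair.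
Proof.
by apply: (@measurable_funD _ _ R setT (fun z => z.1) (fun z => z.2));
  [exact: measurable_fst|exact: measurable_snd].
Qed.

HB.instance Definition _ :=
  isMeasurableFun.Build _ _ _ _ add_pair measurable_add_pair.

Definition convolve (mu nu : rprob R) : rprob R :=
  distribution (mu \x nu)%E add_pair.

(* conv_upto p k is p 1 * ... * p k; the value p 0 is never used. *)
Fixpoint conv_upto (p : nat -> rprob R) (k : nat) : rprob R :=
  if k is k'.+1 then convolve (conv_upto p k') (p k) else \d_(0 : R).

End convolution.

Section geometric_mixture.
Variables (R : realType) (a : R).
Hypothesis a01 : 0 < a < 1.
Variable p : nat -> rprob R.

Definition geom_mixture of 0 < a < 1 := fun A : set R =>
  ((1 - a)%:E *
    (\d_(0%R : R) A + \sum_(1 <= k <oo) (a ^+ k)%:E * conv_upto p k A))%E.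

Local Notation mix := (geom_mixture a01).

Let a_ge0 : 0 <= a. Proof. by case/andP: a01 => /ltW. Qed.

Let oma_ge0 : 0 <= 1 - a.
Proof. by rewrite subr_ge0; case/andP: a01 => _ /ltW. Qed.

Let ak_ge0 k : 0 <= a ^+ k. Proof. exact: exprn_ge0. Qed.

Let mixE : mix = mscale (NngNum oma_ge0)
  (measure_add (\d_(0%R : R) : {measure set R -> \bar R})
    (mseries (fun k => mscale (NngNum (ak_ge0 k)) (conv_upto p k)) 1)).
Proof.
by apply/funext => A; congr (_ * _)%E; apply/esym; exact: measure_addE.
Qed.

Let mix0 : mix set0 = 0%E. Proof. by rewrite mixE measure0. Qed.

Let mix_ge0 A : (0 <= mix A)%E. Proof. by rewrite mixE measure_ge0. Qed.

Let mix_sigma_additive : semi_sigma_additive mix.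
Proof. by rewrite mixE; exact: measure_semi_sigma_additive. Qed.

HB.instance Definition _ :=
  isMeasure.Build _ _ _ mix mix0 mix_ge0 mix_sigma_additive.

Let mix_setT : mix setT = 1%E.
Proof.
have conv1 k : conv_upto p k setT = 1%E by rewrite probability_setT.
have a1 : `|a| < 1 by rewrite ger0_norm//; case/andP: a01.
have n1a : 1 - a != 0 by rewrite subr_eq0 eq_sym lt_eqF//; case/andP: a01.
have sumE : (\sum_(1 <= k <oo) (a ^+ k)%:E * conv_upto p k setT =
    (a / (1 - a))%:E)%E.
  apply/cvg_lim => //; rewrite -cvg_shiftS.
  rewrite [X in X @ _ --> _](_ : _ = EFin \o series (geometric a a)).
    by apply: cvg_EFin; [exact: nearW|exact: cvg_geometric_series].
  apply/funext => n /=; transitivity (\sum_(1 <= k < n.+1) a ^+ k)%:E.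
    by rewrite -sumEFin; apply: eq_bigr => k _; rewrite conv1 mule1.
  by rewrite big_add1; congr EFin; apply: eq_bigr => k _; rewrite exprS.
rewrite /geom_mixture sumE diracT -EFinD -EFinM; congr EFin.
by rewrite mulrDr mulr1 mulrCA divff// mulr1 subrK.
Qed.

HB.instance Definition _ := Measure_isProbability.Build _ _ _ mix mix_setT.

End geometric_mixture.

Definition weak_cvg (R : realType) (mus : nat -> rprob R) (mu : rprob R) : Prop :=
  forall f : R -> R,
    {within `[0, +oo[, continuous f} ->
    [bounded f x | x in `[0, +oo[] ->
    (\int[mus n]_(x in `[0, +oo[) f x)%R @[n --> \oo]
      --> (\int[mu]_(x in `[0, +oo[) f x)%R.

Definition dFM (R : realType) (mu nu : rprob R) : R :=
  sup [set `|(\int[mu]_(x in `[0, +oo[) f x) - (\int[nu]_(x in `[0, +oo[) f x)| |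
    f in [set f : R -> R | (forall x : R, 0 <= x -> -1 <= f x <= 1) /\
                           1.-lipschitz_(`[0, +oo[) f]].

Definition laplace (R : realType) (mu : rprob R) (l : R) : R :=
  (\int[mu]_(t in `[0, +oo[) expR (- (l * t)))%R.

Definition infinitely_divisible (R : realType) (nu : rprob R) : Prop :=
  forall k : nat, (0 < k)%N ->
    exists2 mu : rprob R, on_nonneg mu &
      forall A, measurable A -> nu A = conv_upto (fun=> mu) k A.

(* mu is nu^tau: the Laplace transform determines a measure on [0, oo). *)
Definition is_conv_power (R : realType) (nu : rprob R) (tau : R)
    (mu : rprob R) : Prop :=
  on_nonneg mu /\ forall l : R, 0 <= l -> laplace mu l = laplace nu l `^ tau.

Definition nsteps (R : realType) (a tau : R) : nat :=
  `|Num.ceil (tau / (1 - a))|%N.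

(* remainder of m after division by d, taken in {1, ..., d} *)
Definition mod_pos (m d : nat) : nat :=
  if (d %| m)%N then d else (m %% d)%N.

Section conditions.
Variables (R : realType) (a : nat -> R).
Hypothesis a01 : forall n, 0 < a n < 1.
(* p n m is pi_n^m; only the indices m >= 1 are used. *)
Variable p : nat -> nat -> rprob R.

Definition rho_seq (n : nat) : rprob R := geom_mixture (p n) (a01 n).

Definition condA_for (nu : rprob R) : Prop :=
  [/\ on_nonneg nu, nu [set 0] = 0%E, infinitely_divisible nu &
    forall tau : R, 0 < tau -> exists2 nutau : rprob R,
      is_conv_power nu tau nutau &
      weak_cvg (fun n => conv_upto (p n) (nsteps (a n) tau)) nutau].

Definition condA : Prop := exists nu, condA_for nu.

Definition condB1_for (rho : rprob R) : Prop :=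
  [/\ on_nonneg rho, rho [set 0] = 0%E & weak_cvg rho_seq rho].

Definition condB1 : Prop := exists rho, condB1_for rho.

Definition condB2 : Prop :=
  exists nu : rprob R, [/\ on_nonneg nu, nu [set 0] = 0%E &
    weak_cvg (fun n => conv_upto (p n) (nsteps (a n) 1)) nu].

Definition condC : Prop :=
  (forall tau delta : R, 0 < tau -> 0 < delta ->
    ereal_sup [set p n m `[delta, +oo[%classic | m in
      [set m | (1 <= m <= nsteps (a n) tau)%N]] @[n --> \oo] --> 0%E) /\
  exists d : nat -> nat,
    [/\ forall n, (0 < d n)%N,
        (1 - a n) * (d n)%:R @[n --> \oo] --> 0 &
        forall tau : R, 0 < tau ->
          \sum_(1 <= m < (nsteps (a n) tau).+1)
            dFM (p n m) (p n (mod_pos m (d n))) @[n --> \oo] --> 0].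

End conditions.

(* Main.v *)
From HB Require Import structures.
Require Import Defs.
From mathcomp Require Import all_boot all_order all_algebra.
From mathcomp Require Import all_classical all_reals all_analysis.
From mathcomp Require Import measurable_realfun.
From mathcomp Require Import ring lra.
Set Implicit Arguments.
Unset Strict Implicit.
Unset Printing Implicit Defensive.
Import Order.TTheory GRing.Theory Num.Theory.
Import numFieldNormedType.Exports.
Local Open Scope classical_set_scope.
Local Open Scope ring_scope.

(** The proof reads everything off Laplace transforms. Fix [l >= 0], let
    [b n m] be minus the logarithm of the transform of [p n m] at [l] (this is
    [exponent l n m] below), and let [S n k] be the sum of the [b n m] for
    [1 <= m <= k]. The transform of [conv_upto (p n) k] is [exp (- S n k)],
    and the transform of the mixture is the discounted sum of
    [a^k exp (- S n k)] with total weight one.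

    Condition (C) makes the array infinitesimal and almost periodic with a
    period [d n] that is short on the time scale [1 / (1 - a n)]. Summing over
    whole periods shows that, as long as the rates stay bounded, [S n k] is
    nearly [k (1 - a n) c n] up to any horizon [T / (1 - a n)], where [c n] is
    the mean rate over one period ([linear_rate_periodic]). Either limit then
    determines the rate: (B2) evaluates [S n] at time one, and under (B1) the
    discounted sum is close to [1 / (1 + c n)], a strictly monotone function
    of the rate. Hence [c n] tends to some [psi], and the transform of the
    convolution up to time [tau] tends to [exp (- tau psi)]. Since [rho] has
    transform [1 / (1 + psi)] and [nu] has transform [exp (- psi)], this is
    also the asserted relation. When (A) is given instead of (C), the linear
    growth of [S n] follows from pointwise convergence because [S n] is
    monotone ([pointwise_linear_growth]).

    Returning from transforms to measures takes three facts. Convergence of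
    transforms to the transform of a probability measure implies weak
    convergence ([laplace_weak_cvg]): a bounded continuous [f], damped by
    [exp (- l x)], is a continuous function of [exp (- l x)] and so a uniform
    limit of polynomials in it, whose integrals are combinations of
    transforms. Uniqueness of the transform ([laplace_inj]) follows. A limit
    of transforms that tends to one at the origin is itself a transform
    ([laplace_limit]): a limit of the distribution functions along an
    ultrafilter gives the measure, and comparing exponentials with staircases
    on a fine grid identifies its transform. The powers of [nu] are then the
    limits for the various [tau], and the power [1 / k] is the convolution
    root that infinite divisibility asks for. *)

(** * Discounted sums of linearly growing exponents *)

Section steps.
Variable R : realType.
Implicit Types a tau c : R.

Lemma natr_nsteps a tau : a < 1 -> 0 <= tau ->
  (nsteps a tau)%:R = (Num.ceil (tau / (1 - a)))%:~R :> R.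
Proof.
move=> a1 tau0; rewrite /nsteps natr_absz ger0_norm// ceil_ge0.
by rewrite (lt_le_trans (ltrN10 R))// divr_ge0// subr_ge0 ltW.
Qed.

Lemma nsteps_ge a tau : a < 1 -> 0 <= tau ->
  tau <= (nsteps a tau)%:R * (1 - a).
Proof.
move=> a1 tau0; rewrite -ler_pdivrMr ?subr_gt0// natr_nsteps//.
exact: ceil_ge.
Qed.

Lemma nsteps_lt a tau : a < 1 -> 0 <= tau ->
  (nsteps a tau)%:R * (1 - a) < tau + (1 - a).
Proof.
move=> a1 tau0; have a1' : 0 < 1 - a by rewrite subr_gt0.
rewrite -ltr_pdivlMr// mulrDl divff ?gt_eqF// natr_nsteps//.
by have := ceilB1_lt (tau / (1 - a)); rewrite intrB ltrBlDr.
Qed.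

Lemma nsteps_min a tau k : a < 1 -> 0 <= tau -> tau <= k%:R * (1 - a) ->
  (nsteps a tau <= k)%N.
Proof.
move=> a1 tau0 tk; have a1' : 0 < 1 - a by rewrite subr_gt0.
rewrite -ltnS -(ltr_nat R) -(ltr_pM2r a1') (lt_le_trans (nsteps_lt a1 tau0))//.
by rewrite -natr1 mulrDl mul1r lerD2r.
Qed.

Lemma le_nsteps a tau k : a < 1 -> k%:R * (1 - a) <= tau ->
  (k <= nsteps a tau)%N.
Proof.
move=> a1 kt; have a1' : 0 < 1 - a by rewrite subr_gt0.
rewrite -(ler_nat R) -(ler_pM2r a1') (le_trans kt)// nsteps_ge//.
by rewrite (le_trans _ kt)// mulr_ge0// ltW.
Qed.

(** The weight of the geometric series beyond time [tau] is at most
    [exp (- tau)], uniformly in [a]; this is what allows a cut-off. *)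
Lemma expr_nsteps_le a tau : 0 < a < 1 -> 0 <= tau ->
  a ^+ nsteps a tau <= expR (- tau).
Proof.
move=> /andP[a0 a1] tau0.
have aE : a <= expR (- (1 - a)) by rewrite -{1}(subKr 1 a) expR_ge1Dx.
rewrite (le_trans (lerXn2r _ _ _ aE)) ?nnegrE ?expR_ge0 ?(ltW a0)//.
by rewrite -expRM_natl ler_expR mulrN lerN2 nsteps_ge.
Qed.

Lemma sum_geometric_expR (a c : R) N :
  (1 - a * expR (- ((1 - a) * c))) *
  (\sum_(k < N) a ^+ k * expR (- (k%:R * (1 - a) * c))) =
  1 - (a * expR (- ((1 - a) * c))) ^+ N.
Proof.
have := subrXX 1 (a * expR (- ((1 - a) * c))) N; rewrite expr1n => ->.
congr (_ * _); apply: eq_bigr => k _.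
by rewrite expr1n mul1r exprMn -expRM_natl mulrN mulrA.
Qed.

(** Closed form of the discounted sum of the exactly linear exponent
    [k (1 - a) c]; the geometric ratio is [a exp (- (1 - a) c)]. *)
Definition discounted_rate a c := (1 - a) / (1 - a * expR (- ((1 - a) * c))).

(** With [h = (1 - a) c], the two bounds come from
    [1 - h <= exp (- h) <= 1 / (1 + h)]; they meet at [1 / (1 + c)] as [a]
    tends to one. *)
Lemma discounted_rate_bounds a c : 0 < a < 1 -> 0 <= c ->
  (1 + c)^-1 <= discounted_rate a c <= (1 + a * c / (1 + (1 - a) * c))^-1.
Proof.
move=> /andP[a0 a1] c0; rewrite /discounted_rate.
have a1' : 0 < 1 - a by rewrite subr_gt0.
set h := (1 - a) * c; have h0 : 0 <= h by rewrite mulr_ge0// ltW.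
have e1 : 1 - h <= expR (- h) by rewrite expR_ge1Dx.
have e2 : expR (- h) <= (1 + h)^-1.
  by rewrite expRN lef_pV2 ?posrE ?expR_gt0 ?expR_ge1Dx// ltr_wpDr.
have h1 : 0 < 1 + h by rewrite ltr_wpDr.
have e3 : expR (- h) <= 1 by rewrite expR_le1 oppr_le0.
have q1 : 0 < 1 - a * expR (- h).
  by rewrite subr_gt0 (le_lt_trans _ a1)// ler_piMr// ltW.
have -> : (1 - a) / (1 - a * expR (- h)) = ((1 - a * expR (- h)) / (1 - a))^-1.
  by rewrite invf_div.
have qa : 0 < (1 - a * expR (- h)) / (1 - a) by rewrite divr_gt0.
have c1 : 0 <= a * c / (1 + h) by rewrite !mulr_ge0// ?invr_ge0 ltW.
rewrite !lef_pV2 ?posrE ?ltr_wpDr//; apply/andP; split.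
  rewrite ler_pdivrMr//; have := ler_wpM2l (ltW a0) e1.
  rewrite /h => ?.
  have : 0 <= (1 - a) * (1 - a) * c by rewrite !mulr_ge0// ltW.
  lra.
rewrite ler_pdivlMr//.
have -> : (1 + a * c / (1 + h)) * (1 - a) = 1 - a * (1 + h)^-1.
  by rewrite /h; field; rewrite -/h gt_eqF.
by rewrite lerD2l lerN2 ler_wpM2l// ltW.
Qed.

Lemma discounted_rate_cvg (u : nat -> R) c : (forall n, 0 < u n < 1) ->
  0 <= c -> u n @[n --> \oo] --> (1 : R) ->
  discounted_rate (u n) c @[n --> \oo] --> (1 + c)^-1.
Proof.
move=> u01 c0 u1.
have c1 : 1 + c != 0 by rewrite gt_eqF// ltr_wpDr.
apply: (@squeeze_cvgr _ _ _ _ (fun=> (1 + c)^-1)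
    (fun n => (1 + u n * c / (1 + (1 - u n) * c))^-1)).
- by apply: nearW => n; apply: discounted_rate_bounds.
- exact: cvg_cst.
have d1 : (1 + (1 - u n) * c) @[n --> \oo] --> (1 + (1 - 1) * c : R).
  apply: cvgD; first exact: cvg_cst.
  by apply: cvgMl; apply: cvgB => //; exact: cvg_cst.
rewrite subrr mul0r addr0 in d1.
have -> : (1 + c)^-1 = (1 + 1 * c / 1)^-1 by rewrite mul1r divr1.
apply: cvgV; first by rewrite mul1r divr1.
apply: cvgD; first exact: cvg_cst.
apply: cvgM; first by apply: cvgMl.
by apply: cvgV => //; rewrite oner_eq0.
Qed.

Lemma discounted_sum_le a c eta r (S : nat -> R) N : 0 < a < 1 -> 0 <= c ->
  r <= (1 - a) * (\sum_(k < N) a ^+ k * expR (- S k)) + a ^+ N ->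
  (forall k, (k < N)%N -> k%:R * (1 - a) * c - eta <= S k) ->
  r <= expR eta * discounted_rate a c + a ^+ N.
Proof.
move=> /andP[a0 a1] c0 rS SE; apply: (le_trans rS); rewrite lerD2r.
have a1' : 0 < 1 - a by rewrite subr_gt0.
have e3 : expR (- ((1 - a) * c)) <= 1.
  by rewrite expR_le1 oppr_le0 mulr_ge0// ltW.
have q1 : 0 < 1 - a * expR (- ((1 - a) * c)).
  by rewrite subr_gt0 (le_lt_trans _ a1)// ler_piMr// ltW.
rewrite /discounted_rate mulrCA ler_pM2l//.
have h k : (k < N)%N -> a ^+ k * expR (- S k) <=
    expR eta * (a ^+ k * expR (- (k%:R * (1 - a) * c))).
  move=> /SE Sk; rewrite mulrCA ler_wpM2l ?exprn_ge0 ?(ltW a0)//.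
  by rewrite -expRD ler_expR; lra.
apply: (@le_trans _ _ (\sum_(k < N)
    expR eta * (a ^+ k * expR (- (k%:R * (1 - a) * c))))).
  by apply: ler_sum => k _; apply: h.
rewrite -mulr_sumr ler_wpM2l ?expR_ge0//.
rewrite -[leRHS]mul1r ler_pdivlMr// mulrC sum_geometric_expR.
by rewrite gerBl exprn_ge0// mulr_ge0 ?expR_ge0// ltW.
Qed.

Lemma discounted_sum_ge a c eta r (S : nat -> R) N : 0 < a < 1 -> 0 <= c ->
  0 <= eta ->
  (1 - a) * (\sum_(k < N) a ^+ k * expR (- S k)) <= r ->
  (forall k, (k < N)%N -> S k <= k%:R * (1 - a) * c + eta) ->
  expR (- eta) * discounted_rate a c - a ^+ N <= r.
Proof.
move=> /andP[a0 a1] c0 eta0 rS SE; apply: (le_trans _ rS).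
have a1' : 0 < 1 - a by rewrite subr_gt0.
have e3 : expR (- ((1 - a) * c)) <= 1.
  by rewrite expR_le1 oppr_le0 mulr_ge0// ltW.
have qa : a * expR (- ((1 - a) * c)) <= a by rewrite ler_piMr// ltW.
have q1 : 0 < 1 - a * expR (- ((1 - a) * c)).
  by rewrite subr_gt0 (le_lt_trans _ a1).
have e4 : expR (- eta) <= 1 by rewrite expR_le1 oppr_le0.
apply: (@le_trans _ _ ((1 - a) * (\sum_(k < N)
    expR (- eta) * (a ^+ k * expR (- (k%:R * (1 - a) * c)))))); last first.
  rewrite ler_pM2l//; apply: ler_sum => k _.
  rewrite mulrCA ler_wpM2l ?exprn_ge0 ?(ltW a0)//.
  by rewrite -expRD ler_expR; have := SE k (ltn_ord k); lra.
rewrite -mulr_sumr; set G := \sum_(k < N) _.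
have GE : G = (1 - (a * expR (- ((1 - a) * c))) ^+ N) /
    (1 - a * expR (- ((1 - a) * c))).
  by rewrite -sum_geometric_expR mulrC mulKf// gt_eqF.
have -> : (1 - a) * (expR (- eta) * G) = expR (- eta) * discounted_rate a c -
   expR (- eta) * discounted_rate a c * (a * expR (- ((1 - a) * c))) ^+ N.
  by rewrite GE /discounted_rate; field; rewrite gt_eqF.
rewrite lerD2l lerN2; set q := a * _ in qa q1 *.
have q0 : 0 <= q by rewrite mulr_ge0 ?expR_ge0// ltW.
have dr1 : discounted_rate a c <= 1.
  by rewrite /discounted_rate ler_pdivrMr// mul1r lerD2l lerN2.
have dr0 : 0 <= discounted_rate a c.
  by rewrite /discounted_rate divr_ge0// ltW.
apply: (@le_trans _ _ (1 * q ^+ N)).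
  by rewrite ler_wpM2r ?exprn_ge0// -[leRHS]mul1r ler_pM// expR_ge0.
by rewrite mul1r lerXn2r// nnegrE ltW.
Qed.

(** The number [r] is the sum of the series [(1 - q) q^k exp (- s k)], expressed
    through partial sums: for [s >= 0] the terms after the [N]-th add up to at
    most [q^N]. *)
Definition discounted_sum (q : R) (s : nat -> R) (r : R) := forall N,
  (1 - q) * (\sum_(k < N) q ^+ k * expR (- s k)) <= r <=
  (1 - q) * (\sum_(k < N) q ^+ k * expR (- s k)) + q ^+ N.

(** The horizon [T] makes the tail small and [eta] absorbs the error in the
    exponent. Both depend on [eps] alone, so the rate may be compared
    with a constant before it is known to converge or even to be bounded. *)
Lemma discounted_sum_near (u : nat -> R) c eps : (forall n, 0 < u n < 1) ->
  u n @[n --> \oo] --> (1 : R) -> 0 <= c -> 0 < eps ->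
  exists T eta : R, [/\ 0 < T, 0 < eta & \forall n \near \oo,
  forall r (S : nat -> R), discounted_sum (u n) S r ->
    ((forall k, (k <= nsteps (u n) T)%N ->
       k%:R * (1 - u n) * c - eta <= S k) -> r <= (1 + c)^-1 + eps) /\
    ((forall k, (k <= nsteps (u n) T)%N ->
       S k <= k%:R * (1 - u n) * c + eta) -> (1 + c)^-1 - eps <= r)].
Proof.
move=> u01 u1 c0 e0.
have e4 : 0 < eps / 4 by rewrite divr_gt0.
have T0 : 0 < 4 / eps by rewrite divr_gt0.
have eta0 : 0 < ln (1 + eps / 4) by rewrite ln_gt0// ltrDl.
(* Both exp (- T) and exp eta - 1 are then at most eps / 4. *)
exists (4 / eps), (ln (1 + eps / 4)); split => //.
have eT : expR (- (4 / eps)) <= eps / 4.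
  rewrite expRN -[leRHS]invf_div lef_pV2 ?posrE ?expR_gt0//.
  by rewrite (le_trans _ (expR_ge1Dx _))// lerDr.
have en : expR (ln (1 + eps / 4)) = 1 + eps / 4.
  by rewrite lnK// posrE ltr_wpDr// ltW.
near=> n => r S rS.
have [/andP[un0 un1] n1] : 0 < u n < 1 /\
    `|(1 + c)^-1 - discounted_rate (u n) c| < eps / 4.
  split => //; near: n.
  by move/cvgrPdist_lt: (discounted_rate_cvg u01 c0 u1); apply.
have /andP[dr1 dr2] := discounted_rate_bounds (u01 n) c0.
have dr3 : (1 + u n * c / (1 + (1 - u n) * c))^-1 <= 1.
  have t0 : 0 <= u n * c / (1 + (1 - u n) * c).
    by rewrite mulr_ge0 ?invr_ge0 ?addr_ge0 ?mulr_ge0 ?subr_ge0// ltW.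
  by rewrite invf_le1 ?lerDl ?ltr_wpDr.
set g := discounted_rate (u n) c in n1 dr1 dr2.
have g1 : g <= 1 := le_trans dr2 dr3.
have g0 : 0 <= g by rewrite (le_trans _ dr1)// invr_ge0 addr_ge0.
have uT : u n ^+ nsteps (u n) (4 / eps) <= eps / 4.
  by rewrite (le_trans (expr_nsteps_le (u01 n) (ltW T0))).
have eg : eps / 4 * g <= eps / 4 by rewrite ler_piMr// ltW.
move: n1; rewrite ltr_norml => /andP[n1 n2].
split => SE.
  have /andP[_ rN] := rS (nsteps (u n) (4 / eps)).
  have := discounted_sum_le (u01 n) c0 rN (fun k kN => SE k (ltnW kN)).
  rewrite en -/g; lra.
have /andP[rN _] := rS (nsteps (u n) (4 / eps)).
have := discounted_sum_ge (u01 n) c0 (ltW eta0) rN (fun k kN => SE k (ltnW kN)).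
rewrite expRN en -/g.
have : 1 - eps / 4 <= (1 + eps / 4)^-1.
  rewrite -[leRHS]mul1r ler_pdivlMr ?ltr_wpDr ?(ltW e4)//.
  have : 0 <= eps / 4 * (eps / 4) by rewrite mulr_ge0 ?ltW.
  lra.
move/(ler_wpM2r g0); lra.
Unshelve. all: by end_near. Qed.

End steps.

(** * Linear growth of almost periodic partial sums *)

Section linear_growth.
Variable R : realType.
Implicit Types (b : nat -> R) (S : nat -> nat -> R).

Lemma mod_pos_small m d : (0 < m <= d)%N -> mod_pos m d = m.
Proof.
move=> /andP[m0]; rewrite leq_eqVlt => /predU1P[->|md]; rewrite /mod_pos.
  by rewrite dvdnn.
by rewrite gtnNdvd// modn_small.
Qed.

Lemma mod_pos_add q m d : mod_pos (q * d + m) d = mod_pos m d.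
Proof. by rewrite /mod_pos dvdn_addr ?dvdn_mull// modnMDl. Qed.

Definition psum b k := \sum_(1 <= m < k.+1) b m.

Lemma psum0 b : psum b 0 = 0. Proof. by rewrite /psum big_geq. Qed.

Lemma psumS b k : psum b k.+1 = psum b k + b k.+1.
Proof. by rewrite /psum big_nat_recr. Qed.

Lemma psum_le b : (forall m, 0 <= b m) ->
  {homo psum b : j k / (j <= k)%N >-> j <= k}.
Proof.
move=> b0 j k /subnKC <-; elim: (k - j)%N => [|i IH]; first by rewrite addn0.
by rewrite addnS psumS (le_trans IH)// lerDl.
Qed.

Lemma psum_ge0 b k : (forall m, 0 <= b m) -> 0 <= psum b k.
Proof. by move=> b0; rewrite -(psum0 b) psum_le. Qed.

(** Each period contributes the same amount, and the first period is the
    original sequence because residues are taken in [{1, ..., d}]. *)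
Lemma psum_mod_pos b d q : psum (fun m => b (mod_pos m d)) (q * d) =
  q%:R * psum b d.
Proof.
elim: q => [|q IH]; first by rewrite mul0n psum0 mul0r.
rewrite -natr1 mulrDl mul1r -IH mulSnr.
have : forall r, (r <= d)%N ->
    psum (fun m => b (mod_pos m d)) (q * d + r) =
    psum (fun m => b (mod_pos m d)) (q * d) + psum b r.
  elim=> [|r IHr] rd; first by rewrite addn0 psum0 addr0.
  rewrite addnS !psumS IHr ?(ltnW rd)// -addrA -addnS mod_pos_add.
  by rewrite mod_pos_small.
exact.
Qed.

Lemma psum_mod_pos_bounds b d k : (forall m, 0 <= b m) -> (0 < d)%N ->
  (k %/ d)%:R * psum b d <= psum (fun m => b (mod_pos m d)) k
    <= (k %/ d).+1%:R * psum b d.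
Proof.
move=> b0 d0; rewrite -!psum_mod_pos; apply/andP; split; apply: psum_le => //.
  exact: leq_trunc_div.
by rewrite ltnW// ltn_ceil.
Qed.

Lemma psum_dist b b' k N : (k <= N)%N ->
  `|psum b k - psum b' k| <= psum (fun m => `|b m - b' m|) N.
Proof.
move=> kN; rewrite /psum -sumrB (le_trans (ler_norm_sum _ _ _))//.
by apply: (@psum_le (fun m => `|b m - b' m|)).
Qed.

Variable a : nat -> R.
Hypothesis a01 : forall n, 0 < a n < 1.
Hypothesis a1 : a n @[n --> \oo] --> (1 : R).

Let a'0 n : 0 < 1 - a n.
Proof. by rewrite subr_gt0; case/andP: (a01 n). Qed.

(** The rate [c n] may vary with [n] and may be unbounded, so the approximation
    of [S n k] by [k (1 - a n) c n] is asserted through one-sided comparisons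
    with constants [M]. *)
Definition linear_rate S (c : nat -> R) := forall T eta M, 0 < T -> 0 < eta ->
  \forall n \near \oo,
    (M <= c n -> forall k, (k <= nsteps (a n) T)%N ->
      k%:R * (1 - a n) * M - eta <= S n k) /\
    (c n <= M -> forall k, (k <= nsteps (a n) T)%N ->
      S n k <= k%:R * (1 - a n) * M + eta).

Definition linear_growth S psi := forall T eta, 0 < T -> 0 < eta ->
  \forall n \near \oo, forall k, (k <= nsteps (a n) T)%N ->
    `|S n k - k%:R * (1 - a n) * psi| <= eta.

(** The rate is the sum over one period divided by the time
    [d n * (1 - a n)] that a period takes. An incomplete period shifts the
    time by at most [d n * (1 - a n)], which vanishes, and replacing [b n m]
    by its periodic copy changes every partial sum by at most the total
    deviation. *)
Lemma linear_rate_periodic (b : nat -> nat -> R) (d : nat -> nat) :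
  (forall n m, 0 <= b n m) -> (forall n, (0 < d n)%N) ->
  (1 - a n) * (d n)%:R @[n --> \oo] --> (0 : R) ->
  (forall T, 0 < T -> psum (fun m => `|b n m - b n (mod_pos m (d n))|)
     (nsteps (a n) T) @[n --> \oo] --> (0 : R)) ->
  exists2 c : nat -> R, (forall n, 0 <= c n) &
    linear_rate (fun n => psum (b n)) c.
Proof.
move=> b0 d0 ad bd.
have dr0 n : 0 < (d n)%:R :> R by rewrite ltr0n.
exists (fun n => psum (b n) (d n) / ((d n)%:R * (1 - a n))).
  by move=> n; rewrite divr_ge0 ?psum_ge0// mulr_ge0// ltW.
move=> T eta M T0 eta0.
(* Both comparisons are trivial for a negative constant. *)
have [M0|M0] := ltP M 0.
  apply: nearW => n; split.
    move=> _ k _; have : 0 <= k%:R * (1 - a n) * - M.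
      by rewrite !mulr_ge0// ?oppr_ge0 ltW.
    by have := psum_ge0 k (b0 n); lra.
  move=> cM; suff : 0 <= psum (b n) (d n) / ((d n)%:R * (1 - a n)).
    by move=> /le_trans/(_ cM); rewrite leNgt M0.
  by rewrite divr_ge0 ?psum_ge0// mulr_ge0// ltW.
have e2 : 0 < eta / 2 by rewrite divr_gt0.
near=> n.
have H1 : psum (fun m => `|b n m - b n (mod_pos m (d n))|) (nsteps (a n) T)
    < eta / 2.
  have : `|0 - psum (fun m => `|b n m - b n (mod_pos m (d n))|)
      (nsteps (a n) T)| < eta / 2.
    by near: n; move/cvgrPdist_lt: (bd T T0); apply.
  by rewrite sub0r normrN; apply: le_lt_trans; rewrite ler_norm.
have H2 : (1 - a n) * (d n)%:R * M < eta / 2.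
  have : `|0 - (1 - a n) * (d n)%:R| < eta / 2 / (M + 1).
    near: n; move/cvgrPdist_lt: ad; apply; rewrite divr_gt0//.
    by rewrite ltr_wpDl.
  have ad0 : 0 <= (1 - a n) * (d n)%:R by rewrite mulr_ge0// ltW.
  rewrite sub0r normrN ger0_norm// ltr_pdivlMr ?ltr_wpDl//.
  by apply: le_lt_trans; rewrite ler_wpM2l// lerDl.
have kd k : (k %/ d n)%:R * (d n)%:R <= k%:R :> R.
  by rewrite -natrM ler_nat leq_trunc_div.
have kd' k : k%:R <= (k %/ d n).+1%:R * (d n)%:R :> R.
  by rewrite -natrM ler_nat ltnW// ltn_ceil.
split => cM k kN; have := psum_dist (b n)
    (fun m => b n (mod_pos m (d n))) kN;
  rewrite ler_norml => /andP[bk1 bk2];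
  have /andP[pk1 pk2] := psum_mod_pos_bounds k (b0 n) (d0 n).
  move: cM; rewrite ler_pdivlMr ?mulr_gt0// => cM.
  have Mk : k%:R * (1 - a n) * M <=
      (k %/ d n).+1%:R * (d n)%:R * ((1 - a n) * M).
    by rewrite -[leLHS]mulrA ler_wpM2r// mulr_ge0// ltW.
  have := ler_wpM2l (ler0n R (k %/ d n)) cM.
  move: Mk; rewrite -natr1; lra.
move: cM; rewrite ler_pdivrMr ?mulr_gt0// => cM.
have Mk : (k %/ d n)%:R * (d n)%:R * ((1 - a n) * M) <= k%:R * (1 - a n) * M.
  by rewrite -[leRHS]mulrA ler_wpM2r// mulr_ge0// ltW.
have := ler_wpM2l (ler0n R (k %/ d n).+1) cM.
move: Mk pk2; rewrite -natr1; lra.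
Unshelve. all: by end_near. Qed.

Lemma linear_rate_growth S c psi : linear_rate S c ->
  (forall M, M < psi -> \forall n \near \oo, M <= c n) ->
  (forall M, psi < M -> \forall n \near \oo, c n <= M) ->
  linear_growth S psi.
Proof.
move=> Sc cge cle T eta T0 eta0.
have e2 : 0 < eta / 2 by rewrite divr_gt0.
have T1 : 0 < T + 1 by rewrite addr_gt0.
pose del := eta / 2 / (T + 1); have del0 : 0 < del by rewrite divr_gt0.
have delE : del * (T + 1) = eta / 2 by rewrite /del divfK// gt_eqF.
near=> n => k kN; rewrite ler_distl.
have kT : k%:R * (1 - a n) <= T + 1.
  have /andP[an0 an1] := a01 n.
  apply: (@le_trans _ _ ((nsteps (a n) T)%:R * (1 - a n))).
    by rewrite ler_wpM2r ?(ltW (a'0 n))// ler_nat.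
  rewrite (le_trans (ltW (nsteps_lt an1 (ltW T0))))//; lra.
have kdel : k%:R * (1 - a n) * del <= eta / 2.
  by rewrite -delE [leRHS]mulrC ler_wpM2r// ltW.
have M1 : psi - del <= c n.
  by near: n; apply: cge; rewrite ltrBlDr ltrDl.
have M2 : c n <= psi + del by near: n; apply: cle; rewrite ltrDl.
have /(_ _)/wrap[//|[/(_ M1 k kN) S1 _]] :=
  near (Sc T (eta / 2) (psi - del) T0 e2) n.
have /(_ _)/wrap[//|[_ /(_ M2 k kN) S2]] :=
  near (Sc T (eta / 2) (psi + del) T0 e2) n.
by apply/andP; split; lra.
Unshelve. all: by end_near. Qed.

Let nsteps_cvg tau : 0 <= tau ->
  (nsteps (a n) tau)%:R * (1 - a n) @[n --> \oo] --> tau.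
Proof.
move=> tau0; apply: (@squeeze_cvgr _ _ _ _ (fun=> tau) (fun n => tau + (1 - a
  n))).
- apply: nearW => n; have /andP[an0 an1] := a01 n.
  by rewrite nsteps_ge// ltW// nsteps_lt.
- exact: cvg_cst.
rewrite -[X in _ --> X]addr0 -(subrr (1 : R)).
by apply: cvgD; [exact: cvg_cst|apply: cvgB => //; exact: cvg_cst].
Qed.

Lemma linear_growth_cvg S psi tau : 0 < tau -> linear_growth S psi ->
  S n (nsteps (a n) tau) @[n --> \oo] --> tau * psi.
Proof.
move=> tau0 Sp.
have -> : (fun n => S n (nsteps (a n) tau)) = fun n =>
    (S n (nsteps (a n) tau) - (nsteps (a n) tau)%:R * (1 - a n) * psi) +
    (nsteps (a n) tau)%:R * (1 - a n) * psi.
  by apply/funext => n; rewrite subrK.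
rewrite -[X in _ --> X]add0r; apply: cvgD.
  apply/cvgrPdist_le => e e0; near=> n; rewrite sub0r normrN.
  have /(_ _)/wrap[//|Spn] := near (Sp tau e tau0 e0) n.
  exact: Spn.
by apply: cvgMl; apply: nsteps_cvg; exact: ltW.
Unshelve. all: by end_near. Qed.

(** Monotone functions that converge pointwise to a continuous one converge
    uniformly on bounded intervals: it is enough to control finitely many
    times [j * del], of mesh so small that [del * (psi + 1) = eta / 2]. *)
Lemma pointwise_linear_growth S psi : 0 <= psi ->
  (forall n, S n 0%N = 0) ->
  (forall n, {homo S n : j k / (j <= k)%N >-> j <= k}) ->
  (forall tau, 0 < tau -> S n (nsteps (a n) tau) @[n --> \oo] --> tau * psi) ->
  linear_growth S psi.
Proof.
move=> psi0 S0 Snd Scvg T eta T0 eta0.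
have S_ge0 n k : 0 <= S n k by rewrite -(S0 n) Snd.
have e2 : 0 < eta / 2 by rewrite divr_gt0.
have p1 : 0 < psi + 1 by rewrite ltr_wpDl.
pose del := eta / 2 / (psi + 1); have del0 : 0 < del by rewrite divr_gt0.
have delE : del * (psi + 1) = eta / 2 by rewrite /del divfK// gt_eqF.
(* Rounding up the number of steps adds at most one unit of time to T. *)
pose J := (Num.truncn ((T + 1) / del)).+1.
have SJ : \forall n \near \oo, forall j, (j < J.+1)%N ->
    `|S n (nsteps (a n) (j%:R * del)) - j%:R * del * psi| <= eta / 2.
  elim: J.+1 => [|N IH]; first exact: nearW.
  have SN : \forall n \near \oo,
      `|S n (nsteps (a n) (N%:R * del)) - N%:R * del * psi| <= eta / 2.
    have [->|N0] := posnP N.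
      apply: nearW => n; rewrite mul0r mul0r subr0.
      have -> : nsteps (a n) 0 = 0%N by rewrite /nsteps mul0r ceil0.
      by rewrite S0 normr0 ltW.
    have := Scvg (N%:R * del); rewrite mulr_gt0 ?ltr0n// => /(_ isT).
    by move/cvgrPdist_le/(_ _ e2); apply: filterS => n; rewrite distrC.
  apply: filterS2 IH SN => n IH SN j; rewrite ltnS leq_eqVlt => /predU1P[->//|].
  exact: IH.
apply: filterS SJ => n SJ k kN; rewrite ler_distl.
have /andP[an0 an1] := a01 n.
have kT : k%:R * (1 - a n) <= T + 1.
  apply: (@le_trans _ _ ((nsteps (a n) T)%:R * (1 - a n))).
    by rewrite ler_wpM2r ?(ltW (a'0 n))// ler_nat.
  rewrite (le_trans (ltW (nsteps_lt an1 (ltW T0))))//; lra.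
pose j := Num.truncn (k%:R * (1 - a n) / del).
have k0 : 0 <= k%:R * (1 - a n) / del.
  by apply: divr_ge0; [exact: mulr_ge0 (ler0n _ _) (ltW (a'0 n))|exact: ltW].
have /andP[j1 j2] : j%:R * del <= k%:R * (1 - a n) < j.+1%:R * del.
  by rewrite -ler_pdivlMr// -ltr_pdivrMr//; exact: truncn_itv.
have jJ : (j.+1 < J.+1)%N.
  rewrite ltnS /J ltnS /j truncn_le_nat ?natr_nat//.
  rewrite (@le_lt_trans _ _ ((T + 1) / del))//;
    first by rewrite ler_pM2r ?invr_gt0.
  exact: truncnS_gt.
have := SJ j (ltnW jJ); have := SJ _ jJ; rewrite !ler_distl.
move=> /andP[u1 u2] /andP[l1 l2].
have Sl : S n (nsteps (a n) (j%:R * del)) <= S n k.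
  by apply: Snd; apply: nsteps_min => //; rewrite mulr_ge0// ltW.
have Su : S n k <= S n (nsteps (a n) (j.+1%:R * del)).
  by apply: Snd; apply: le_nsteps => //; exact: ltW.
have := ler_wpM2r psi0 j1; have := ler_wpM2r psi0 (ltW j2).
move: u1 u2 Su j2; rewrite -natr1 => u1 u2 Su j2 v1 v2.
by apply/andP; split; lra.
Qed.

End linear_growth.

(** * The limits that identify the rate *)

Section identification.
Variables (R : realType) (a : nat -> R) (S : nat -> nat -> R).
Hypothesis a01 : forall n, 0 < a n < 1.
Hypothesis a1 : a n @[n --> \oo] --> (1 : R).

Let a'0 n : 0 < 1 - a n.
Proof. by rewrite subr_gt0; case/andP: (a01 n). Qed.

(** A rate that stays above (below) a constant [M] keeps [S n] at time one
    above (below) about [M], so the limit [psi] separates the admissible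
    constants. *)
Lemma growth_of_nsteps1 (c : nat -> R) (psi : R) : (forall n, 0 <= c n) -> 0 <=
    psi ->
  linear_rate a S c -> S n (nsteps (a n) 1) @[n --> \oo] --> psi ->
  linear_growth a S psi.
Proof.
move=> c0 psi0 Sc Spsi; apply: (linear_rate_growth a01 Sc) => [M Mpsi|M psiM].
  have [M0|M0] := ltP M 0.
    by apply: nearW => n; rewrite (le_trans (ltW M0)).
  pose e := (psi - M) / 4; have e0 : 0 < e by rewrite divr_gt0// subr_gt0.
  near=> n; rewrite leNgt; apply/negP => /ltW cM.
  have /(_ _)/wrap[//|[_ /(_ cM _ (leqnn _))]] := near (Sc 1 e M ltr01 e0) n.
  have : `|psi - S n (nsteps (a n) 1)| < e.
    by near: n; move/cvgrPdist_lt: Spsi; apply.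
  have : `|1 - a n| < e / (M + 1).
    by near: n; move/cvgrPdist_lt: a1; apply; rewrite divr_gt0// ltr_wpDl.
  rewrite gtr0_norm// ltr_pdivlMr ?ltr_wpDl// => aM.
  have /andP[_ an1] := a01 n.
  have := ler_wpM2r M0 (ltW (nsteps_lt an1 ler01)).
  have eE : psi - M = 4 * e by rewrite /e; field.
  by rewrite ltr_norml => ? /andP[? ?] ?; have := a'0 n; lra.
pose e := (M - psi) / 2; have e0 : 0 < e by rewrite divr_gt0// subr_gt0.
have M0 : 0 <= M by rewrite (le_trans psi0)// ltW.
near=> n; rewrite leNgt; apply/negP => /ltW cM.
have /(_ _)/wrap[//|[/(_ cM _ (leqnn _)) + _]] := near (Sc 1 e M ltr01 e0) n.
have : `|psi - S n (nsteps (a n) 1)| < e.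
  by near: n; move/cvgrPdist_lt: Spsi; apply.
have /andP[_ an1] := a01 n.
have := ler_wpM2r M0 (nsteps_ge an1 ler01).
have eE : M - psi = 2 * e by rewrite /e; field.
by rewrite ltr_norml => ? /andP[? ?] ?; lra.
Unshelve. all: by end_near. Qed.

(** A rate above (below) [M] pushes the discounted sum below (above)
    about [1 / (1 + M)]; as this is strictly decreasing in [M], the limit [r']
    forces the rate to [1 / r' - 1]. *)
Lemma growth_of_discounted_sum (c r : nat -> R) (r' : R) : (forall n, 0 <= c n)
    ->
  0 < r' <= 1 -> linear_rate a S c ->
  (forall n, discounted_sum (a n) (S n) (r n)) -> r n @[n --> \oo] --> r' ->
  linear_growth a S (r'^-1 - 1).
Proof.
move=> c0 /andP[r'0 r'1] Sc rS rr'.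
have psi0 : 0 <= r'^-1 - 1 by rewrite subr_ge0 invf_ge1.
apply: (linear_rate_growth a01 Sc) => [M Mpsi|M psiM].
  have [M0|M0] := ltP M 0.
    by apply: nearW => n; rewrite (le_trans (ltW M0)).
  have rM : r' < (1 + M)^-1.
    have M1 : 0 < 1 + M by rewrite ltr_wpDr.
    by rewrite -[ltLHS]invrK ltf_pV2 ?posrE ?invr_gt0//; lra.
  pose e := ((1 + M)^-1 - r') / 2; have e0 : 0 < e by rewrite divr_gt0//
    subr_gt0.
  have [T [eta [T0 eta0 near_r]]] := discounted_sum_near a01 a1 M0 e0.
  near=> n; rewrite leNgt; apply/negP => /ltW cM.
  have /(_ _)/wrap[//|[_ /(_ cM) Sk]] := near (Sc T eta M T0 eta0) n.
  have /(_ _)/wrap[//|/(_ _ _ (rS n))[_ /(_ Sk)]] := near near_r n.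
  have : `|r' - r n| < e by near: n; move/cvgrPdist_lt: rr'; apply.
  rewrite ltr_norml /e => /andP[? ?]; lra.
have M0 : 0 <= M by rewrite (le_trans psi0)// ltW.
have rM : (1 + M)^-1 < r'.
  have M1 : 0 < 1 + M by rewrite ltr_wpDr.
  by rewrite -[ltRHS]invrK ltf_pV2 ?posrE ?invr_gt0//; lra.
pose e := (r' - (1 + M)^-1) / 2; have e0 : 0 < e by rewrite divr_gt0// subr_gt0.
have [T [eta [T0 eta0 near_r]]] := discounted_sum_near a01 a1 M0 e0.
near=> n; rewrite leNgt; apply/negP => /ltW cM.
have /(_ _)/wrap[//|[/(_ cM) Sk _]] := near (Sc T eta M T0 eta0) n.
have /(_ _)/wrap[//|/(_ _ _ (rS n))[/(_ Sk) + _]] := near near_r n.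
have : `|r' - r n| < e by near: n; move/cvgrPdist_lt: rr'; apply.
rewrite ltr_norml /e => /andP[? ?]; lra.
Unshelve. all: by end_near. Qed.

Lemma discounted_sum_growth_cvg (r : nat -> R) (psi : R) : 0 <= psi ->
  linear_growth a S psi -> (forall n, discounted_sum (a n) (S n) (r n)) ->
  r n @[n --> \oo] --> (1 + psi)^-1.
Proof.
move=> psi0 Sg rS; apply/cvgrPdist_le => e e0.
have [T [eta [T0 eta0 near_r]]] := discounted_sum_near a01 a1 psi0 e0.
have Sn := Sg T eta T0 eta0.
apply: filterS2 near_r Sn => n near_r Sn; have [rl ru] := near_r _ _ (rS n).
rewrite distrC ler_distl rl ?ru// => k kN; have := Sn k kN;
  by rewrite ler_distl => /andP[].
Qed.

End identification.

(** * Polynomial approximation *)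

Section weierstrass.
Variable R : realType.
Implicit Types (f g : nat -> R) (u x : R).

(** The Bernstein polynomial of the values [f 0, ..., f N], obtained by
    conditioning on the first of [N] Bernoulli trials. The recursion gives
    positivity and the moments by induction, without binomial sums. *)
Fixpoint bernstein N f : {poly R} :=
  if N is N'.+1 then
    'X * bernstein N' (fun k => f k.+1) + (1 - 'X) * bernstein N' f
  else (f 0%N)%:P.

Lemma bernsteinS N f u : (bernstein N.+1 f).[u] =
  u * (bernstein N (fun k => f k.+1)).[u] + (1 - u) * (bernstein N f).[u].
Proof. by rewrite /= !hornerE. Qed.

Lemma bernstein_le N f g u : 0 <= u <= 1 ->
  (forall k, (k <= N)%N -> f k <= g k) ->
  (bernstein N f).[u] <= (bernstein N g).[u].
Proof.
move=> /andP[u0 u1]; elim: N f g => [|N IH] f g fg.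
  by rewrite /= !hornerE; exact: fg.
rewrite !bernsteinS lerD// ler_wpM2l ?subr_ge0//; apply: IH => k kN.
  exact: fg.
by apply: fg; rewrite leqW.
Qed.

(** The second moment about [x] of a binomial variable is its variance plus
    the square of the distance from its mean to [x]. *)
Lemma bernstein_quadratic N u x (al be : R) :
  (bernstein N (fun k => al + be * (k%:R - x) ^+ 2)).[u] =
  al + be * (N%:R * (u * (1 - u)) + (N%:R * u - x) ^+ 2).
Proof.
elim: N x => [|N IH] x; first by rewrite /= !hornerE; ring.
rewrite bernsteinS IH.
rewrite (_ : (fun k => _) = fun k => al + be * (k%:R - (x - 1)) ^+ 2).
  by rewrite IH -natr1; ring.
by apply/funext => k; rewrite -natr1; ring.
Qed.

(** Uniform continuity in the form that a variance bound can use: nearby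
    points are handled by [e], and for points at distance at least [d / 2] the
    quadratic term exceeds the trivial bound [2 M]. *)
Lemma quadratic_modulus (g : R -> R) M e : 0 < e ->
  (forall x, `[0, 1]%classic x -> g y @[y --> x] --> g x) ->
  (forall x, `[0, 1]%classic x -> `|g x| <= M) ->
  exists2 K, 0 <= K & forall x y, `[0, 1]%classic x -> `[0, 1]%classic y ->
    `|g x - g y| <= e + K * (x - y) ^+ 2.
Proof.
move=> e0 gc gM.
have M0 : 0 <= M by rewrite (le_trans _ (gM 0 _))//= in_itv/= lexx ler01.
have e2 : 0 < e / 2 by rewrite divr_gt0.
have /compact_near_coveringP/near_covering_withinP cov := @segment_compact R 0
    1.
have : \forall K \near +oo, `[0, 1]%classic `<=` (fun x =>
    forall y, `[0, 1]%classic y -> `|g x - g y| <= e + K * (x - y) ^+ 2).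
  apply: cov => x x01.
  have /cvgrPdist_lt/(_ _ e2)/nbhs_ballP[/= d d0 gd] := gc x x01.
  have d2 : 0 < d / 2 by rewrite divr_gt0.
  exists (ball x (d / 2), [set K | 8 * M / d ^+ 2 <= K]).
    split; first exact: nbhsx_ballx.
    by apply: nbhs_pinfty_ge; rewrite num_real.
  move=> [x' K] /= [xx' KM] x'01 y y01.
  have K0 : 0 <= K by rewrite (le_trans _ KM)// !mulr_ge0// invr_ge0 sqr_ge0.
  rewrite /ball/= in xx'.
  have [xy|xy] := ltP `|x - y| d.
    have gxx' : `|g x - g x'| < e / 2.
      by apply: gd; rewrite /ball/= (lt_trans xx')// ltr_pdivrMr// ltr_pMr//
          ltr1n.
    have gxy : `|g x - g y| < e / 2 by apply: gd.
    rewrite (_ : g x' - g y = - (g x - g x') + (g x - g y)); last by ring.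
    rewrite (le_trans (ler_normD _ _))// normrN.
    have : 0 <= K * (x' - y) ^+ 2 by rewrite mulr_ge0// sqr_ge0.
    lra.
  have x'y : d / 2 <= `|x' - y|.
    have := ler_normD (x - x') (x' - y); rewrite addrA subrK => ?.
    lra.
  have x'y2 : (d / 2) ^+ 2 <= (x' - y) ^+ 2.
    by rewrite -[leRHS]real_normK ?num_real// lerXn2r// nnegrE// ltW.
  have KM2 : 2 * M <= K * (x' - y) ^+ 2.
    apply: (@le_trans _ _ (8 * M / d ^+ 2 * (d / 2) ^+ 2)).
      by rewrite le_eqVlt; apply/orP; left; apply/eqP; field; rewrite gt_eqF.
    by apply: ler_pM => //; rewrite ?sqr_ge0// !mulr_ge0// invr_ge0 sqr_ge0.
  have := ler_normB (g x') (g y); have := gM _ x'01; have := gM _ y01.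
  lra.
move=> near_K; near +oo_R => K.
exists K; first by near: K; apply: nbhs_pinfty_ge; rewrite num_real.
by move=> x y x01 y01; have /(_ _)/wrap[//|] := near near_K K; exact.
Unshelve. all: by end_near. Qed.

(** Averaging the quadratic modulus over the binomial law with [N] trials,
    scaled by [1 / N], gives a variance of order [1 / N]. *)
Lemma weierstrass (g : R -> R) M e : 0 < e ->
  (forall x, `[0, 1]%classic x -> g y @[y --> x] --> g x) ->
  (forall x, `[0, 1]%classic x -> `|g x| <= M) ->
  exists P : {poly R}, forall u, 0 <= u <= 1 -> `|g u - P.[u]| <= e.
Proof.
move=> e0 gc gM; have e2 : 0 < e / 2 by rewrite divr_gt0.
have [K K0 gK] := quadratic_modulus e2 gc gM.
(* The variance term is K / N * u (1 - u), so N only has to beat K. *)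
pose N := (Num.truncn (K / (e / 2))).+1.
have N0 : 0 < N%:R :> R by rewrite ltr0n.
have KN : K / N%:R <= e / 2.
  rewrite ler_pdivrMr// mulrC -ler_pdivrMr//; apply: ltW; exact: truncnS_gt.
exists (bernstein N (fun k => g (k%:R / N%:R))) => u u01.
have u01' : `[0, 1]%classic u by rewrite /= in_itv.
have gk k : (k <= N)%N -> `|g u - g (k%:R / N%:R)| <=
    e / 2 + K / N%:R ^+ 2 * (k%:R - N%:R * u) ^+ 2.
  move=> kN; rewrite (le_trans (gK _ _ u01' _))//=.
    rewrite in_itv/= divr_ge0//= ler_pdivrMr// mul1r ler_nat//.
  rewrite lerD2l le_eqVlt; apply/orP; left; apply/eqP.
  by field; rewrite gt_eqF.
have qle : e / 2 + K / N%:R ^+ 2 * (N%:R * (u * (1 - u)) + (N%:R * u - N%:R *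
    u) ^+ 2)
    <= e.
  rewrite subrr expr0n addr0.
  have -> : K / N%:R ^+ 2 * (N%:R * (u * (1 - u))) = K / N%:R * (u * (1 - u)).
    by field; rewrite gt_eqF.
  have : u * (1 - u) <= 1 by case/andP: u01 => ? ?; nra.
  have KN0 : 0 <= K / N%:R by rewrite divr_ge0.
  by move/(ler_wpM2l KN0); lra.
rewrite distrC ler_distl; apply/andP; split.
  have := bernstein_quadratic N u (N%:R * u) (g u - e / 2) (- (K / N%:R ^+ 2)).
  set b := bernstein _ _ => bE.
  have : b.[u] <= (bernstein N (fun k => g (k%:R / N%:R))).[u].
    apply: bernstein_le => // k /gk; rewrite ler_norml => /andP[_].
    by rewrite mulNr; lra.
  by rewrite bE mulNr; lra.
have := bernstein_quadratic N u (N%:R * u) (g u + e / 2) (K / N%:R ^+ 2).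
set b := bernstein _ _ => bE.
have : (bernstein N (fun k => g (k%:R / N%:R))).[u] <= b.[u].
  apply: bernstein_le => // k /gk; rewrite ler_norml => /andP[+ _].
  lra.
by rewrite bE; lra.
Qed.

End weierstrass.

(** * Laplace transforms and convolution *)

Section integral_nonneg.
Variable R : realType.
Implicit Types (mu nu : rprob R) (f g : R -> R).

Local Notation D := (`[0%R, +oo[%classic : set R).

Lemma on_nonnegC mu : on_nonneg mu -> mu (~` D) = 0%E.
Proof. by move=> muD; rewrite probability_setC// [X in (1 - X)%E]muD subee. Qed.

Lemma on_pos_nonneg mu : on_pos mu -> on_nonneg mu.
Proof.
move=> mup; apply/eqP; rewrite eq_le probability_le1//= -mup.
by rewrite le_measure ?inE//; apply: subset_itvr; rewrite bnd_simp.
Qed.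

Lemma integrable_nonneg mu f M : measurable_fun D f ->
  (forall x, 0 <= x -> `|f x| <= M) -> mu.-integrable D (EFin \o f).
Proof.
move=> mf fM; apply: measurable_bounded_integrable => //.
  by rewrite (le_lt_trans (probability_le1 mu _))// ltry.
exists M; split; first exact: num_real.
move=> y My x /=; rewrite in_itv/= andbT => x0.
by rewrite (le_trans (fM x x0))// ltW.
Qed.

Lemma Rintegral_cst_nonneg mu c : on_nonneg mu -> \int[mu]_(x in D) c = c.
Proof. by move=> muD; rewrite Rintegral_cst// [X in fine X]muD mulr1. Qed.

Lemma Rintegral_dist mu f g e M : on_nonneg mu -> 0 <= e ->
  measurable_fun D f -> measurable_fun D g ->
  (forall x, 0 <= x -> `|f x| <= M) ->
  (forall x, 0 <= x -> `|f x - g x| <= e) ->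
  `|\int[mu]_(x in D) f x - \int[mu]_(x in D) g x| <= e.
Proof.
move=> muD e0 mf mg fM fg.
have If : mu.-integrable D (EFin \o f) by exact: (@integrable_nonneg _ _ M).
have gM x : 0 <= x -> `|g x| <= M + e.
  move=> x0; have -> : g x = f x - (f x - g x) by rewrite subKr.
  by rewrite (le_trans (ler_normB _ _))// lerD// ?fM// fg.
have Ig : mu.-integrable D (EFin \o g) by exact: (@integrable_nonneg _ _ (M +
    e)).
rewrite -RintegralB//.
have Ifg : mu.-integrable D (EFin \o (fun x => f x - g x)).
  by apply: (@integrable_nonneg _ _ e) => //; apply: measurable_funB.
apply: (le_trans (le_normr_Rintegral _ _)) => //.
rewrite -[leRHS](Rintegral_cst_nonneg e muD) le_Rintegral//.
- apply: (@integrable_nonneg _ _ e).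
    by apply: measurableT_comp => //; apply: measurable_funB.
  by move=> x x0; rewrite normr_id fg.
- apply: (@integrable_nonneg _ _ e) => // x x0.
  by rewrite ger0_norm.
- by move=> x; rewrite /= in_itv/= andbT => /fg.
Qed.

End integral_nonneg.

Section laplace.
Variable R : realType.
Implicit Types (mu nu : rprob R) (l : R).

Local Notation D := (`[0%R, +oo[%classic : set R).

Lemma measurable_expRM l E : measurable_fun E (fun t : R => expR (- (l * t))).
Proof.
apply: measurable_funTS; apply: continuous_measurable_fun => x.
apply: (@continuous_comp _ _ _ (fun t => - (l * t)) expR).
  by apply: cvgN; apply: cvgMr; exact: cvg_id.
exact: continuous_expR.
Qed.

Lemma expRM_bounds l x : 0 <= l -> 0 <= x -> 0 <= expR (- (l * x)) <= 1.
Proof. by move=> l0 x0; rewrite expR_ge0 expR_le1 oppr_le0 mulr_ge0. Qed.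

Lemma integrable_expRM mu l : 0 <= l ->
  mu.-integrable D (EFin \o (fun t => expR (- (l * t)))).
Proof.
move=> l0; apply: (@integrable_nonneg _ _ _ 1); first exact: measurable_expRM.
by move=> x x0; have /andP[e0 e1] := expRM_bounds l0 x0; rewrite ger0_norm.
Qed.

(** The integral over the whole line is the form to which Fubini and the
    series of measures apply without tracking the half-line. *)
Lemma laplaceE mu l : on_nonneg mu -> 0 <= l ->
  (laplace mu l)%:E = (\int[mu]_t (expR (- (l * t)))%:E)%E.
Proof.
move=> muD l0; rewrite /laplace /Rintegral fineK; last first.
  by apply: integrable_fin_num => //; exact: integrable_expRM.
rewrite [RHS](@ge0_negligible_integral _ _ _ _ _ (~` D))//.
- by rewrite setTD setCK.
- exact: measurableC.
- by apply/measurable_EFinP; exact: measurable_expRM.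
- exact: on_nonnegC.
Qed.

Lemma laplace_le1 mu l : 0 <= l -> laplace mu l <= 1.
Proof.
move=> l0; apply: (@le_trans _ _ (\int[mu]_(x in D) 1)).
  apply: le_Rintegral => //.
  - exact: integrable_expRM.
  - by apply: (@integrable_nonneg _ _ _ 1) => // x _; rewrite normr1.
  - by move=> x; rewrite /= in_itv/= andbT => /(expRM_bounds l0)/andP[].
rewrite Rintegral_cst// mul1r -lee_fin fineK ?fin_num_measure//.
exact: probability_le1.
Qed.

Lemma laplace_ge0 mu l : 0 <= laplace mu l.
Proof. by apply: Rintegral_ge0 => x _; rewrite expR_ge0. Qed.

Lemma laplace0 mu : on_nonneg mu -> laplace mu 0 = 1.
Proof.
move=> muD; rewrite -[RHS](Rintegral_cst_nonneg 1 muD);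
  apply: eq_Rintegral => x _.
by rewrite mul0r oppr0 expR0.
Qed.

Lemma laplace_gt0 mu l : on_nonneg mu -> 0 <= l -> 0 < laplace mu l.
Proof.
move=> muD l0; rewrite lt_neqAle laplace_ge0 andbT eq_sym; apply/eqP => L0.
have : (\int[mu]_(t in setT) `|(expR (- (l * t)))%:E| = 0)%E.
  under eq_integral do rewrite gee0_abs ?lee_fin ?expR_ge0//.
  by rewrite -laplaceE// L0.
move/ae_eq_integral_abs => /(_ measurableT).
have mE : measurable_fun setT (fun t : R => (expR (- (l * t)))%:E).
  by apply/measurable_EFinP; exact: measurable_expRM.
case/(_ mE) => N [mN N0 sub].
have : mu setT = 0%E.
  apply/eqP; rewrite eq_le measure_ge0 andbT -N0 le_measure ?inE// => x _.
  apply: sub => /= /(_ I) [] /eqP; by rewrite gt_eqF ?expR_gt0.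
by rewrite probability_setT => -[] /eqP; rewrite oner_eq0.
Qed.

Lemma on_nonneg_dirac0 : on_nonneg (\d_(0 : R) : rprob R).
Proof. by rewrite /on_nonneg/= diracE mem_set//= in_itv/= lexx. Qed.

Lemma laplace_dirac0 l : laplace (\d_(0 : R) : rprob R) l = 1.
Proof.
rewrite /laplace /Rintegral integral_dirac//.
  by rewrite diracE mem_set/= ?in_itv/= ?lexx//;
    rewrite mulr0 oppr0 expR0 mul1r.
by apply/measurable_EFinP; exact: measurable_expRM.
Qed.

Lemma on_nonneg_convolve mu nu : on_nonneg mu -> on_nonneg nu ->
  on_nonneg (convolve mu nu).
Proof.
move=> muD nuD; apply/eqP; rewrite eq_le probability_le1//=.
have : (mu \x nu)%E (D `*` D) = 1%E.
  by rewrite product_measure1E// [X in (X * _)%E]muD [X in (_ * X)%E]nuD mule1.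
move=> <-; rewrite /convolve /distribution /pushforward le_measure ?inE//.
- exact: measurableX.
- by rewrite -[X in measurable X]setTI; exact: measurable_add_pair.
- move=> [x y] [/=]; rewrite !in_itv/= !andbT => x0 y0.
  exact: addr_ge0.
Qed.

Lemma laplace_convolve mu nu l : on_nonneg mu -> on_nonneg nu -> 0 <= l ->
  laplace (convolve mu nu) l = laplace mu l * laplace nu l.
Proof.
move=> muD nuD l0; apply: EFin_inj.
rewrite laplaceE//; last exact: on_nonneg_convolve.
have mE : measurable_fun setT (fun t : R => (expR (- (l * t)))%:E).
  by apply/measurable_EFinP; exact: measurable_expRM.
rewrite /convolve ge0_integral_distribution// fubini_tonelli1//=; last first.
  by apply: (measurableT_comp mE); exact: measurable_add_pair.
transitivity (\int[mu]_x ((laplace nu l)%:E * (expR (- (l * x)))%:E))%E.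
  apply: eq_integral => x _; rewrite laplaceE// muleC -ge0_integralZl//.
  by apply: eq_integral => y _; rewrite /= mulrDr opprD expRD EFinM.
rewrite ge0_integralZl//; last by rewrite lee_fin laplace_ge0.
by rewrite -laplaceE// muleC EFinM.
Qed.

Lemma on_nonneg_conv_upto (p : nat -> rprob R) k :
  (forall m, (0 < m)%N -> on_nonneg (p m)) -> on_nonneg (conv_upto p k).
Proof.
move=> pD; elim: k => [|k IH] /=; first exact: on_nonneg_dirac0.
by apply: on_nonneg_convolve => //; exact: pD.
Qed.

Lemma laplace_conv_upto (p : nat -> rprob R) k l : 0 <= l ->
  (forall m, (0 < m)%N -> on_nonneg (p m)) ->
  laplace (conv_upto p k) l = \prod_(1 <= m < k.+1) laplace (p m) l.
Proof.
move=> l0 pD; elim: k => [|k IH]; first by rewrite big_geq//= laplace_dirac0.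
rewrite big_nat_recr//= laplace_convolve ?IH//; last exact: pD.
exact: on_nonneg_conv_upto.
Qed.

End laplace.

(** * Laplace transform of the geometric mixture *)

Section mixture.
Variables (R : realType) (a : R) (a01 : 0 < a < 1) (p : nat -> rprob R).
Hypothesis p_nonneg : forall m, (0 < m)%N -> on_nonneg (p m).

Local Notation D := (`[0%R, +oo[%classic : set R).
Local Notation mix := (geom_mixture p a01).

Let a0 : 0 < a. Proof. by case/andP: a01. Qed.
Let a1 : a < 1. Proof. by case/andP: a01. Qed.
Let ak_ge0 k : 0 <= a ^+ k. Proof. by rewrite exprn_ge0// ltW. Qed.
Let a'_ge0 : 0 <= 1 - a. Proof. by rewrite subr_ge0 ltW. Qed.

(** The Dirac mass is the term [k = 0] of the series, since the empty
    convolution is the Dirac mass at zero. *)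
Lemma geom_mixtureE A : mix A = mscale (NngNum a'_ge0)
  (mseries (fun k => mscale (NngNum (ak_ge0 k)) (conv_upto p k)) 0) A.
Proof.
rewrite /geom_mixture /mscale/= /mseries; congr (_ * _)%E.
by rewrite [RHS]nneseries_recl//; congr (_ + _)%E; exact/esym/mul1e.
Qed.

Lemma on_nonneg_geom_mixture : on_nonneg (mix : rprob R).
Proof.
rewrite /on_nonneg -[RHS](probability_setT (mix : rprob R)) /= /geom_mixture.
congr (_ * (_ + _))%E.
  by rewrite diracT; exact: on_nonneg_dirac0.
apply: eq_eseriesr => k _; congr (_ * _)%E.
by rewrite probability_setT; exact: on_nonneg_conv_upto.
Qed.

Lemma laplace_geom_mixture l : 0 <= l -> ((laplace mix l)%:E =
  (1 - a)%:E * \sum_(0 <= k <oo) (a ^+ k * laplace (conv_upto p k) l)%:E)%E.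
Proof.
move=> l0; rewrite laplaceE//; last exact: on_nonneg_geom_mixture.
have mE : measurable_fun setT (fun t : R => (expR (- (l * t)))%:E).
  by apply/measurable_EFinP; exact: measurable_expRM.
rewrite (eq_measure_integral (mscale (NngNum a'_ge0)
  (mseries (fun k => mscale (NngNum (ak_ge0 k)) (conv_upto p k)) 0)));
    last first.
  by move=> A _ _; exact: geom_mixtureE.
rewrite ge0_integral_mscale//=; congr (_ * _)%E.
rewrite ge0_integral_measure_series//; apply: eq_eseriesr => k _.
rewrite ge0_integral_mscale//= EFinM laplaceE//; exact: on_nonneg_conv_upto.
Qed.

Lemma laplace_geom_mixture_bounds l N : 0 <= l ->
  (1 - a) * (\sum_(k < N) a ^+ k * laplace (conv_upto p k) l) <= laplace mix l
    <=
  (1 - a) * (\sum_(k < N) a ^+ k * laplace (conv_upto p k) l) + a ^+ N.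
Proof.
move=> l0; have convD k : on_nonneg (conv_upto p k) by exact:
  on_nonneg_conv_upto.
have aE0 k : 0 <= a ^+ k * laplace (conv_upto p k) l.
  by rewrite mulr_ge0 ?laplace_ge0.
have a'0 : 0 < 1 - a by rewrite subr_gt0.
have sumN n : (\sum_(0 <= k < n) (a ^+ k * laplace (conv_upto p k) l)%:E =
    (\sum_(k < n) a ^+ k * laplace (conv_upto p k) l)%:E)%E.
  by rewrite sumEFin big_mkord.
have ub : (\sum_(0 <= k <oo) (a ^+ k * laplace (conv_upto p k) l)%:E <=
    (\sum_(k < N) a ^+ k * laplace (conv_upto p k) l + a ^+ N / (1 - a))%:E)%E.
  apply: lime_le; first by apply: is_cvg_nneseries => k _ _; rewrite lee_fin.
  near=> n; rewrite sumN lee_fin.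
  have Nn : (N <= n)%N by near: n; exact: nbhs_infty_ge.
  rewrite -!(big_mkord xpredT (fun k => a ^+ k * laplace (conv_upto p k) l)).
  rewrite (big_cat_nat _ Nn)//= lerD2l.
  apply: (@le_trans _ _ (\sum_(N <= k < n) a ^+ k)).
    by apply: ler_sum => k _; rewrite ler_piMr// laplace_le1.
  rewrite -(subnKC Nn) geometric_partial_tail geometric_le_lim//.
  by rewrite ger0_norm// ltW.
have lb : ((\sum_(k < N) a ^+ k * laplace (conv_upto p k) l)%:E <=
    \sum_(0 <= k <oo) (a ^+ k * laplace (conv_upto p k) l)%:E)%E.
  by rewrite -sumN; apply: nneseries_lim_ge => k _ _; rewrite lee_fin.
rewrite -!lee_fin laplace_geom_mixture//; apply/andP; split.
  by rewrite EFinM lee_pmul2l// lte_fin.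
have -> : a ^+ N = (1 - a) * (a ^+ N / (1 - a)) by rewrite mulrC divfK ?gt_eqF.
by rewrite -mulrDr EFinM lee_pmul2l// lte_fin.
Unshelve. all: by end_near. Qed.

End mixture.

(** * From Laplace transforms to weak convergence *)

Section laplace_limits.
Variable R : realType.
Implicit Types (mu nu : rprob R) (f g : R -> R).

Local Notation D := (`[0%R, +oo[%classic : set R).

Lemma Rintegral_cvg mu (h : nat -> R -> R) f M :
  (forall n, measurable_fun D (h n)) -> measurable_fun D f ->
  (forall n x, 0 <= x -> `|h n x| <= M) ->
  (forall x, 0 <= x -> h n x @[n --> \oo] --> f x) ->
  (\int[mu]_(x in D) h n x)%R @[n --> \oo] --> (\int[mu]_(x in D) f x)%R.
Proof.
move=> mh mf hM hf.
have M0 : 0 <= M by rewrite (le_trans _ (hM 0%N 0 _)).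
have IM : mu.-integrable D (EFin \o cst M).
  by apply: (@integrable_nonneg _ _ _ M) => // x _ /=; rewrite ger0_norm.
have [||||||I1 _ I2] := @dominated_convergence _ _ _ mu D _
  (fun n => EFin \o h n) (EFin \o f) (EFin \o cst M) => //.
- by move=> n; apply/measurable_EFinP.
- exact/measurable_EFinP.
- apply: aeW => x; rewrite /= in_itv/= andbT => x0.
  by apply: cvg_EFin; [exact: nearW|exact: hf].
- apply: aeW => x n; rewrite /= in_itv/= andbT => x0.
  by rewrite lee_fin hM.
by apply: fine_cvg; rewrite fineK//; exact: integrable_fin_num.
Qed.

Lemma laplace_near0 mu e : on_nonneg mu -> 0 < e ->
  exists2 l, 0 < l & 1 - e < laplace mu l.
Proof.
move=> muD e0.
have : laplace mu (harmonic n) @[n --> \oo] --> (\int[mu]_(x in D) 1)%R.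
  apply: (@Rintegral_cvg _ _ _ 1) => //.
  - by move=> n; exact: measurable_expRM.
  - move=> n x x0; have /andP[? ?] := expRM_bounds (@harmonic_ge0 R n) x0.
    by rewrite ger0_norm.
  - move=> x x0; rewrite -(expR0 R); apply: continuous_cvg.
      exact: continuous_expR.
    rewrite -oppr0 -[in X in _ --> X](mul0r x); apply: cvgN.
    by apply: cvgMl; exact: cvg_harmonic.
rewrite Rintegral_cst_nonneg// => /cvgrPdist_lt/(_ _ e0)[N _ /(_ N (leqnn _))].
move=> /= HN; exists (harmonic N) => //; first exact: harmonic_gt0.
by move: HN; rewrite ltr_norml => /andP[]; lra.
Qed.

(** The exponentials [exp (- n x)] decrease to the indicator of zero, so the
    transform tends to the mass at zero. *)
Lemma laplace_infty mu e : mu [set 0] = 0%E -> 0 < e ->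
  exists2 l, 0 <= l & laplace mu l < e.
Proof.
move=> mu0 e0.
have : laplace mu n%:R @[n --> \oo] --> (\int[mu]_(x in D) \1_[set (0 : R)]
    x)%R.
  apply: (@Rintegral_cvg _ _ _ 1) => //.
  - by move=> n; exact: measurable_expRM.
  - move=> n x x0; have /andP[? ?] := expRM_bounds (ler0n R n) x0.
    by rewrite ger0_norm.
  - move=> x x0; rewrite indicE.
    have [->|xn0] := eqVneq x 0.
      rewrite mem_set//=; apply: cvg_near_cst; apply: nearW => n.
      by rewrite mulr0 oppr0 expR0.
    rewrite memNset//=; last exact/eqP.
    have x_gt0 : 0 < x by rewrite lt_neqAle eq_sym xn0.
    have q1 : `|expR (- x)| < 1.
      by rewrite ger0_norm ?expR_ge0// expR_lt1 oppr_lt0.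
    have := cvg_geometric 1 q1; apply: cvg_trans; apply: near_eq_cvg.
    by apply: nearW => n; rewrite /geometric/= mul1r -mulrN -expRM_natl.
rewrite /Rintegral integral_indic//.
rewrite [X in fine X](_ : _ = 0%E); last first.
  apply/eqP; rewrite eq_le measure_ge0 andbT -mu0 le_measure ?inE//.
  exact: measurableI.
move=> /cvgrPdist_lt/(_ _ e0)[N _ /(_ N (leqnn _))] /=.
by rewrite sub0r normrN ger0_norm ?laplace_ge0// => HN; exists N%:R.
Qed.

(** Extending by a constant to the left of zero preserves all integrals over the
    half-line and makes continuity and measurability global. *)
Lemma within_continuous_max0 f : {within D, continuous f} ->
  continuous (fun t : R => f (Num.max 0 t)).
Proof.
move=> /subspace_continuousP fc x.
have x0 : D (Num.max 0 x) by rewrite /= in_itv/= andbT le_max lexx.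
apply: cvg_comp (fc _ x0) => B; rewrite /within/= => wB.
have cmax : (Num.max 0 t : R) @[t --> x] --> Num.max 0 x.
  by apply: continuous_max; [exact: cvg_cst|exact: cvg_id].
suff : \forall t \near x, B (Num.max 0 t) by [].
have : \forall t \near x, D (Num.max 0 t) -> B (Num.max 0 t) by exact: cmax _
    wB.
apply: filterS => t; apply.
by rewrite /= in_itv/= andbT le_max lexx.
Qed.

Lemma Rintegral_sum mu n (c : nat -> R) (h : nat -> R -> R) :
  (forall i, measurable_fun D (h i)) ->
  (forall i x, 0 <= x -> `|h i x| <= 1) ->
  \int[mu]_(x in D) (\sum_(i < n) c i * h i x) =
  \sum_(i < n) c i * \int[mu]_(x in D) h i x.
Proof.
move=> mh h1; have Ih i : mu.-integrable D (EFin \o h i).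
  by apply: (@integrable_nonneg _ _ _ 1) => //; exact: h1.
elim: n => [|n IH].
  under eq_Rintegral do rewrite big_ord0.
  by rewrite Rintegral_cst// mul0r big_ord0.
rewrite big_ord_recr/= -IH -RintegralZl// -RintegralD//; last 2 first.
- apply: (@integrable_nonneg _ _ _ (\sum_(i < n) `|c i|)) => [|x x0].
    by apply: measurable_sum => i; exact: measurable_funM.
  rewrite (le_trans (ler_norm_sum _ _ _))//; apply: ler_sum => i _.
  by rewrite normrM ler_piMr// h1.
- apply: (@integrable_nonneg _ _ _ `|c n|) => [|x x0].
    exact: measurable_funM.
  by rewrite normrM ler_piMr// h1.
by apply: eq_Rintegral => x _; rewrite big_ord_recr.
Qed.

Lemma Rintegral_horner mu l (P : {poly R}) : 0 <= l ->
  \int[mu]_(x in D) P.[expR (- (l * x))] =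
  \sum_(i < size P) P`_i * laplace mu (i%:R * l).
Proof.
move=> l0; have il0 i : 0 <= i%:R * l by rewrite mulr_ge0.
rewrite -(@Rintegral_sum _ _ (fun i => P`_i)
    (fun i t => expR (- (i%:R * l * t)))).
- apply: eq_Rintegral => x _; rewrite horner_coef; apply: eq_bigr => i _.
  by rewrite -expRM_natl mulrN mulrA.
- by move=> i; exact: measurable_expRM.
- move=> i x x0; have /andP[? ?] := expRM_bounds (il0 i) x0.
  by rewrite ger0_norm.
Qed.

(** In the variable [u = exp (- l x)] the function [f x * exp (- l x)] extends
    continuously to [u = 0], because [f] is bounded; the factor [u] makes the
    value given to [ln 0] irrelevant. *)
Lemma damped_continuous f (l M : R) : 0 < l -> continuous f ->
  (forall x, `|f x| <= M) ->
  forall u : R, `[0, 1]%classic u ->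
    (f (- (ln v / l)) * v) @[v --> u] --> (f (- (ln u / l)) * u).
Proof.
move=> l0 fc fM u; rewrite /= in_itv/= => /andP[u0 _].
have [u_gt0|] := ltP 0 u.
  apply: cvgM; last exact: cvg_id.
  apply: (@continuous_comp _ _ _ (fun v => - (ln v / l)) f); last exact: fc.
  by apply: cvgN; apply: cvgMl; exact: continuous_ln.
move=> u_le0; have -> : u = 0 by apply/eqP; rewrite eq_le u_le0.
rewrite mulr0; apply/norm_cvg0P.
apply: (@squeeze_cvgr _ _ _ _ (fun=> 0) (fun v => M * `|v|)).
- by apply: nearW => v; rewrite normr_ge0 normrM ler_wpM2r.
- exact: cvg_cst.
- rewrite -[X in _ --> X](mulr0 M) -[in X in _ --> X](@normr0 _ R).
  by apply: cvgMr; apply: cvg_norm; exact: cvg_id.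
Qed.

(** Damping [f] by [exp (- l x)] changes its integral by at most
    [M (1 - laplace mu l)], which is small for small [l], uniformly along the
    sequence because the transforms at [l] converge. This replaces a tightness
    argument. The damped function is uniformly close to a polynomial in
    [exp (- l x)]. *)
Theorem laplace_weak_cvg (mus : nat -> rprob R) mu :
  (forall n, on_nonneg (mus n)) -> on_nonneg mu ->
  (forall l, 0 <= l -> laplace (mus n) l @[n --> \oo] --> laplace mu l) ->
  weak_cvg mus mu.
Proof.
move=> musD muD Lcvg f0 f0c f0b.
pose f t := f0 (Num.max 0 t).
have fc : continuous f by exact: within_continuous_max0.
have f0f nu : \int[nu]_(x in D) f0 x = \int[nu]_(x in D) f x.
  apply: eq_Rintegral => x; rewrite inE/= in_itv/= andbT => x0.
  by rewrite /f max_r.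
rewrite f0f; under eq_fun do rewrite f0f.
have [M M0 fM] : exists2 M, 0 < M & forall x, `|f x| <= M.
  move: f0b => [M [Mreal f0M]]; exists (`|M| + 1); first by rewrite ltr_wpDl.
  move=> x; apply: (f0M (`|M| + 1)); last first.
    by rewrite /= in_itv/= andbT le_max lexx.
  by rewrite (le_lt_trans (ler_norm M))// ltrDl.
have mf E : measurable_fun E f.
  by apply: measurable_funTS; exact: continuous_measurable_fun.
(* Damping and polynomial approximation cost e / 8 each, for both measures,
   and so does the difference of the integrals of the polynomial. *)
apply/cvgrPdist_le => e e0.
have e8 : 0 < e / 8 by rewrite divr_gt0.
have [l l0 Ll] := laplace_near0 muD (divr_gt0 e8 M0).
have l0' := ltW l0.
have gM (u : R) : `[0, 1]%classic u -> `|f (- (ln u / l)) * u| <= M.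
  rewrite /= in_itv/= => /andP[u0 u1].
  by rewrite normrM -[leRHS]mulr1 ler_pM// ger0_norm.
have [P gP] := weierstrass e8 (damped_continuous l0 fc fM) gM.
have gE x : f (- (ln (expR (- (l * x))) / l)) = f x.
  by rewrite expRK mulNr opprK mulrAC divff ?mul1r// gt_eqF.
have mexp E : measurable_fun E (fun x : R => expR (- (l * x))).
  exact: measurable_expRM.
have mfexp E : measurable_fun E (fun x => f x * expR (- (l * x))).
  exact: measurable_funM.
have fexpM x : 0 <= x -> `|f x * expR (- (l * x))| <= M.
  move=> x0; have /andP[? ?] := expRM_bounds l0' x0.
  by rewrite normrM -[leRHS]mulr1 ler_pM// ger0_norm.
have mP E : measurable_fun E (fun x => P.[expR (- (l * x))]).
  apply: measurable_funTS; apply: (measurableT_comp (f := horner P)) => //.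
  by apply: continuous_measurable_fun; exact: continuous_horner.
have damp nu : on_nonneg nu -> `|\int[nu]_(x in D) f x -
    \int[nu]_(x in D) (f x * expR (- (l * x)))| <= M * (1 - laplace nu l).
  move=> nuD.
  have If : nu.-integrable D (EFin \o f) by exact: (@integrable_nonneg _ _ _ M).
  have Ife : nu.-integrable D (EFin \o (fun x => f x * expR (- (l * x)))).
    exact: (@integrable_nonneg _ _ _ M).
  have I1 : nu.-integrable D (EFin \o (fun=> 1)).
    by apply: (@integrable_nonneg _ _ _ 1) => // x _; rewrite normr1.
  have Ie : nu.-integrable D (EFin \o (fun x => 1 - expR (- (l * x)))).
    apply: (@integrable_nonneg _ _ _ 1).
      by apply: measurable_funB.
    move=> x x0; have /andP[? ?] := expRM_bounds l0' x0.
    by rewrite ger0_norm ?subr_ge0// gerBl.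
  rewrite -RintegralB// -{1}(Rintegral_cst_nonneg 1 nuD) -RintegralB//;
    last first.
    exact: integrable_expRM.
  rewrite -RintegralZl//.
  have mB : measurable_fun D (fun x => f x - f x * expR (- (l * x))).
    exact: measurable_funB.
  have fB x : 0 <= x ->
      `|f x - f x * expR (- (l * x))| <= M * (1 - expR (- (l * x))).
    move=> x0; have /andP[? ?] := expRM_bounds l0' x0.
    rewrite -{1}(mulr1 (f x)) -mulrBr normrM ler_pM//.
    by rewrite ger0_norm// subr_ge0.
  have M1 x : 0 <= x -> M * (1 - expR (- (l * x))) <= M.
    move=> x0; have /andP[? ?] := expRM_bounds l0' x0.
    by rewrite -[leRHS]mulr1 ler_pM ?subr_ge0 ?gerBl// ltW.
  apply: (le_trans (le_normr_Rintegral _ _)) => //.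
    by apply: (@integrable_nonneg _ _ _ M) => // x x0;
        rewrite (le_trans (fB x x0))// M1.
  apply: le_Rintegral => //.
  - apply: (@integrable_nonneg _ _ _ M); first exact: measurableT_comp.
    by move=> x x0; rewrite normr_id (le_trans (fB x x0))// M1.
  - apply: (@integrable_nonneg _ _ _ M).
      by apply: measurable_funM => //; exact: measurable_funB.
    move=> x x0; rewrite ger0_norm ?M1//; rewrite (le_trans _ (fB x x0))//.
  - by move=> x; rewrite /= in_itv/= andbT => /fB.
have approx nu : on_nonneg nu -> `|\int[nu]_(x in D) f x -
    \int[nu]_(x in D) P.[expR (- (l * x))]| <= M * (1 - laplace nu l) + e / 8.
  move=> nuD; set J := \int[nu]_(x in D) (f x * expR (- (l * x))).
  rewrite -(subrKA J) (le_trans (ler_normD _ _))// lerD ?damp//.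
  apply: (@Rintegral_dist _ _ _ _ _ M) => //; first exact: ltW.
  move=> x x0; have := gP _ (expRM_bounds l0' x0); by rewrite gE.
have Pcvg : (\int[mus n]_(x in D) P.[expR (- (l * x))])%R @[n --> \oo] -->
    (\int[mu]_(x in D) P.[expR (- (l * x))])%R.
  rewrite Rintegral_horner//; under eq_fun do rewrite Rintegral_horner//.
  apply: cvg_big => [|i _]; first exact: add_continuous.
  apply: cvgMr.
  by apply: Lcvg; rewrite mulr_ge0.
have Ml nu : 1 - e / 8 / M < laplace nu l -> M * (1 - laplace nu l) <= e / 8.
  by move=> Lnu; rewrite mulrC -ler_pdivlMr//; lra.
near=> n.
have Ln : M * (1 - laplace (mus n) l) <= e / 8.
  apply: Ml; near: n; exact: (cvgr_gt _ (Lcvg l l0')).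
have Pn : `|\int[mu]_(x in D) P.[expR (- (l * x))] -
    \int[mus n]_(x in D) P.[expR (- (l * x))]| < e / 8.
  by near: n; move/cvgrPdist_lt: Pcvg; apply.
have := approx _ muD; have := approx _ (musD n); have := Ml _ Ll.
move: Pn; rewrite ler_distl !ler_norml ltr_norml.
move=> /andP[? ?] ? /andP[? ?] /andP[? ?]; apply/andP; split; lra.
Unshelve. all: by end_near. Qed.

End laplace_limits.

(** * Uniqueness, and measures with a given distribution function *)

Section laplace_uniqueness.
Variable R : realType.
Implicit Types mu nu : rprob R.

Local Notation D := (`[0%R, +oo[%classic : set R).

(** The distribution function of the measure itself, as a real number. *)
Definition dist_fun mu (x : R) : R := fine (mu `]-oo, x]%classic).

Lemma dist_funE mu x : (dist_fun mu x)%:E = mu `]-oo, x]%classic.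
Proof. by rewrite /dist_fun fineK// fin_num_measure. Qed.

Lemma dist_fun_le mu : {homo dist_fun mu : x y / x <= y}.
Proof.
move=> x y xy; rewrite -lee_fin !dist_funE le_measure ?inE//.
exact: subitvPr.
Qed.

Lemma dist_fun_bounds mu x : 0 <= dist_fun mu x <= 1.
Proof. by rewrite -!lee_fin !dist_funE measure_ge0 probability_le1. Qed.

Lemma on_nonnegI mu A : on_nonneg mu -> measurable A -> mu (A `&` D) = mu A.
Proof.
move=> muD mA; rewrite (measureDI mu mA (measurable_itv `[0, +oo[)).
rewrite [X in (X + _)%E](_ : _ = 0%E) ?add0e//.
apply/eqP; rewrite eq_le measure_ge0 andbT -(on_nonnegC muD) le_measure ?inE//.
- exact: measurableD.
- exact: measurableC.
Qed.

Lemma Rintegral_half_line mu x : on_nonneg mu ->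
  \int[mu]_(t in D) \1_(`]-oo, x]%classic) t = dist_fun mu x.
Proof.
by move=> muD; rewrite /Rintegral integral_indic// [X in fine X]on_nonnegI.
Qed.

(** By the weak convergence theorem for a constant sequence, both measures give
    the same integrals to the continuous ramps that decrease to the indicator
    of a left half-line, hence have the same distribution function. *)
Lemma laplace_inj mu nu : on_nonneg mu -> on_nonneg nu ->
  (forall l, 0 <= l -> laplace mu l = laplace nu l) ->
  forall A, measurable A -> mu A = nu A.
Proof.
move=> muD nuD Lmunu.
have mass_eq x : mu `]-oo, x]%classic = nu `]-oo, x]%classic.
  pose ramp (k : nat) (t : R) := Num.max 0 (Num.min 1 (1 - k%:R * (t - x))).
  have ramp_bounds k t : 0 <= ramp k t <= 1.
    by rewrite /ramp le_max lexx/= ge_max ler01/= ge_min lexx.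
  have rampM k t : `|ramp k t| <= 1.
    by have /andP[? ?] := ramp_bounds k t; rewrite ger0_norm.
  have rampC k : continuous (ramp k).
    have lin : continuous (fun t : R => 1 - k%:R * (t - x) : R).
      move=> t; apply: cvgB; first exact: cvg_cst.
      by apply: cvgMr; apply: cvgB; [exact: cvg_id|exact: cvg_cst].
    move=> t; apply: (@continuous_max R R (fun=> 0)
        (fun t => Num.min 1 (1 - k%:R * (t - x)))); first exact: cvg_cst.
    apply: (@continuous_min R R (fun=> 1)); first exact: cvg_cst.
    exact: lin.
  have ramp_eq k : \int[mu]_(t in D) ramp k t = \int[nu]_(t in D) ramp k t.
    have : weak_cvg (fun=> mu) nu.
      apply: laplace_weak_cvg => // l l0; rewrite Lmunu//; exact: cvg_cst.
    move/(_ (ramp k)) => H.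
    have := H (continuous_subspaceT (@rampC k)).
    have bk : [bounded ramp k x | x in D].
      exists 1; split; first exact: num_real.
      by move=> y y1 t _; exact: le_trans (rampM k t) (ltW y1).
    move=> /(_ bk) H1.
    by apply: (cvg_unique (@Rhausdorff R) _ H1); exact: cvg_cst.
  have ramp_cvg (t : R) : ramp k t @[k --> \oo] --> (\1_(`]-oo, x]%classic) t :
      R).
    rewrite indicE; have [tx|xt] := leP t x.
      rewrite mem_set/= ?in_itv//=; apply: cvg_near_cst; apply: nearW => k.
      rewrite /ramp min_l ?max_r// lerBrDl -lerBrDr subrr.
      by rewrite mulr_ge0_le0// subr_le0.
    rewrite memNset/= ?in_itv/=; last by apply/negP; rewrite -ltNge.
    apply: cvg_near_cst; near=> k.
    have tx0 : 0 < t - x by rewrite subr_gt0.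
    have : (t - x)^-1 <= k%:R by near: k; exact: nbhs_infty_ger.
    rewrite -(ler_pM2r tx0) mulVf ?gt_eqF// => kt.
    by apply: max_l; rewrite ge_min subr_le0 kt orbT.
  have ramp_int nu' : on_nonneg nu' ->
      (\int[nu']_(t in D) ramp k t)%R @[k --> \oo] --> dist_fun nu' x.
    move=> nu'D; rewrite -Rintegral_half_line//.
    apply: (@Rintegral_cvg _ _ _ _ 1) => //.
      by move=> k; apply: measurable_funTS; exact: continuous_measurable_fun.
  rewrite -!dist_funE; congr EFin.
  apply: (cvg_unique (@Rhausdorff R) (ramp_int _ muD)).
  have <- : (fun k => \int[nu]_(t in D) ramp k t) =
      (fun k => \int[mu]_(t in D) ramp k t).
    by apply/funext => k; rewrite ramp_eq.
  exact: ramp_int.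
move=> A mA.
apply: (@measure_unique _ _ _ (@ocitv R) (fun k => `](- k%:R), k%:R]%classic))
    => //.
- exact: ocitvI.
- by move=> k; exact: is_ocitv.
- apply/seteqP; split=> // x _; exists (Num.truncn `|x|).+1 => //=.
  have := truncnS_gt `|x|; rewrite ltr_norml in_itv/= => /andP[-> ?].
  exact: ltW.
- move=> _ [[u v] _ <-] /=.
  have [uv|vu] := leP u v; last first.
    by rewrite set_itv_ge ?measure0// bnd_simp -leNgt ltW.
  have uvE (nu' : rprob R) :
      (nu' `]u, v]%classic = nu' `]-oo, v]%classic - nu' `]-oo, u]%classic)%E.
    have -> : `]u, v]%classic = `]-oo, v] `\` `]-oo, u] :> set R.
      by rewrite -[RHS]setCK setCD setCitvl setUC -[LHS]setCK setCitv.
    rewrite measureD ?setIidr//; first exact: subset_itvl.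
    by rewrite -ge0_fin_numE// fin_num_measure.
  by rewrite !uvE !mass_eq.
- by move=> k; rewrite (le_lt_trans (probability_le1 mu _))// ltry.
Unshelve. all: by end_near. Qed.

End laplace_uniqueness.

Section probability_of_cdf.
Variables (R : realType) (F : R -> R).
Hypothesis F_nd : {homo F : x y / x <= y}.
Hypothesis F_rc : right_continuous F.
Hypothesis F_Ny : F @ -oo --> (0 : R).
Hypothesis F_y : F @ +oo --> (1 : R).
Local Open Scope measure_display_scope.

Let f := F.

#[local] HB.instance Definition _ := isCumulative.Build R _ R f F_nd F_rc.
#[local] HB.instance Definition _ := isCumulativeBounded.Build R 0 1 f F_Ny F_y.

Let idTR : measurableTypeR R -> R := idfun.

#[local] HB.instance Definition _ :=
  @isMeasurableFun.Build _ _ _ _ idTR (@measurable_id _ _ setT).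

(** The Lebesgue-Stieltjes measure lives on a differently named copy of
    the Borel space of the line; the identity map carries it over. *)
Lemma probability_of_cdf :
  exists mu : rprob R, forall x, mu `]-oo, x]%classic = (F x)%:E.
Proof.
exists (distribution (lebesgue_stieltjes_measure f)
  (idTR : {RV lebesgue_stieltjes_measure f >-> R})) => x.
exact: cdf_lebesgue_stieltjes_id.
Qed.

End probability_of_cdf.

(** * Staircase approximation of the Laplace transform *)

Section grid.
Variable R : realType.
Implicit Types (F G : R -> R) (l d t : R).

Local Notation D := (`[0%R, +oo[%classic : set R).

Definition grid_weight l d j := expR (- (l * (j%:R * d))) - expR (- (l *
  (j.+1%:R * d))).

(** For the distribution function of a measure this is the integral of the
    staircase that stays below [exp (- l t)] with steps at the [J] first
    multiples of [d], by summation by parts. *)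
Definition grid_sum l d J F := \sum_(j < J) grid_weight l d j * F (j%:R * d).

Lemma expR_gridS l d j :
  expR (- (l * (j%:R * d))) = expR (l * d) * expR (- (l * (j.+1%:R * d))).
Proof. by rewrite -expRD -natr1; congr expR; ring. Qed.

Lemma grid_weight_ge0 l d j : 0 <= l -> 0 <= d -> 0 <= grid_weight l d j.
Proof.
move=> l0 d0; rewrite subr_ge0 ler_expR lerN2 ler_wpM2l// ler_wpM2r//.
by rewrite ler_nat.
Qed.

Lemma grid_sum_le l d J F G : 0 <= l -> 0 <= d ->
  (forall x, F x <= G x) -> grid_sum l d J F <= grid_sum l d J G.
Proof.
by move=> l0 d0 FG; apply: ler_sum => j _; rewrite ler_wpM2l ?grid_weight_ge0.
Qed.

(** On a cell of the grid the exponential varies by the factor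
    [exp (l * d)], and beyond the grid it is at most [exp (- l * J * d)] up to
    the same factor. *)
Lemma grid_sum_indic_bounds l d J t : 0 <= l -> 0 <= d -> 0 <= t ->
  grid_sum l d J (fun x => \1_(`]-oo, x]%classic) t) <= expR (- (l * t)) <=
  expR (l * d) * (grid_sum l d J (fun x => \1_(`]-oo, x]%classic) t) +
    expR (- (l * (J%:R * d)))).
Proof.
move=> l0 d0 t0; set E := fun j : nat => expR (- (l * (j%:R * d))).
set c := fun j : nat => \1_(`]-oo, j%:R * d]%classic) t : R.
set s := fun J => grid_sum l d J (fun x => \1_(`]-oo, x]%classic) t).
have sS n : s n.+1 = s n + (E n - E n.+1) * c n by rewrite /s /grid_sum
    big_ord_recr.
have cE n : c n = (t <= n%:R * d)%R%:R.
  rewrite /c indicE; congr (_%:R); congr nat_of_bool.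
  by apply/idP/idP; rewrite inE/= in_itv.
have s0 n : n%:R * d < t -> s n = 0.
  elim: n => [|n IH] nt; first by rewrite /s /grid_sum big_ord0.
  have nt' : n%:R * d < t by rewrite (le_lt_trans _ nt)// ler_wpM2r// ler_nat.
  by rewrite sS IH// cE leNgt nt' mulr0 addr0.
have Ele n x : x <= n%:R * d -> E n <= expR (- (l * x)).
  by move=> xn; rewrite ler_expR lerN2 ler_wpM2l.
have s_ge0 n : 0 <= s n.
  apply: sumr_ge0 => j _; rewrite mulr_ge0 ?grid_weight_ge0//.
have eld : 1 <= expR (l * d) by rewrite -expR0 ler_expR mulr_ge0.
apply/andP; split.
  have : s J + E J * c J <= expR (- (l * t)).
    elim: J => [|n IH].
      rewrite {1}/s /grid_sum big_ord0 add0r cE.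
      by case: (leP t) => [/Ele|_]; rewrite ?mulr1// mulr0 expR_ge0.
    rewrite sS; case: (leP t (n%:R * d)) => [tn|nt].
      have tn1 : t <= n.+1%:R * d by rewrite (le_trans tn)// ler_wpM2r//
          ler_nat.
      move: IH; rewrite !cE tn tn1 !mulr1; lra.
    rewrite s0// !cE (leNgt t (n%:R * d)) nt/= mulr0 !add0r.
    by case: (leP t) => [/Ele|_]; rewrite ?mulr1// mulr0 expR_ge0.
  by apply: le_trans; rewrite lerDl mulr_ge0 ?expR_ge0// cE.
rewrite -/(s J) -/(E J); elim: J => [|n IH].
  rewrite /s /grid_sum big_ord0 add0r /E mul0r mulr0 oppr0 expR0 mulr1.
  by rewrite (le_trans _ eld)// expR_le1 oppr_le0 mulr_ge0.
have [tn|nt] := leP t (n%:R * d).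
  by move: IH; rewrite sS cE tn mulr1 -addrA subrK.
apply: (@le_trans _ _ (E n)); first by rewrite ler_expR lerN2 ler_wpM2l// ltW.
rewrite mulrDr /E expR_gridS lerDr mulr_ge0 ?expR_ge0//.
Qed.

Lemma laplace_grid_bounds (mu : rprob R) l d J : on_nonneg mu -> 0 <= l ->
  0 <= d -> grid_sum l d J (dist_fun mu) <= laplace mu l <=
  expR (l * d) * (grid_sum l d J (dist_fun mu) + expR (- (l * (J%:R * d)))).
Proof.
move=> muD l0 d0.
pose s t := grid_sum l d J (fun x => \1_(`]-oo, x]%classic) t).
have ms : measurable_fun D s.
  by apply: measurable_sum => j; apply: measurable_funM.
have sE : \int[mu]_(t in D) s t = grid_sum l d J (dist_fun mu).
  rewrite (@Rintegral_sum _ _ _ (grid_weight l d)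
    (fun j => \1_(`]-oo, j%:R * d]%classic)))//.
    by apply: eq_bigr => j _; rewrite Rintegral_half_line.
  by move=> j x _; rewrite indicE normr_nat lern1 leq_b1.
have eJ0 := expR_ge0 (- (l * (J%:R * d))).
have s1 t : 0 <= t -> `|s t| <= 1.
  move=> t0; have /andP[st _] := grid_sum_indic_bounds J l0 d0 t0.
  have /andP[_ et] := expRM_bounds l0 t0.
  rewrite ger0_norm; first exact: le_trans st et.
  apply: sumr_ge0 => j _; rewrite mulr_ge0 ?grid_weight_ge0//.
have Is : mu.-integrable D (EFin \o s) by exact: (@integrable_nonneg _ _ _ 1).
have Ic c : mu.-integrable D (EFin \o (fun=> c)).
  by apply: (@integrable_nonneg _ _ _ `|c|).
have IsD c : mu.-integrable D (EFin \o (fun t => s t + c)).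
  apply: (@integrable_nonneg _ _ _ (1 + `|c|)); first exact: measurable_funD.
  by move=> t /s1 st; rewrite (le_trans (ler_normD _ _))// lerD.
rewrite -sE; apply/andP; split.
  apply: le_Rintegral => //; first exact: integrable_expRM.
  by move=> t; rewrite /= in_itv/= andbT => /(grid_sum_indic_bounds J l0
    d0)/andP[].
rewrite -[X in _ + X](Rintegral_cst_nonneg _ muD) -RintegralD// -RintegralZl//.
apply: le_Rintegral => //; first exact: integrable_expRM.
- apply: (@integrable_nonneg _ _ _ (expR (l * d) * (1 + expR (- (l * (J%:R *
    d)))))).
    by apply: measurable_funM => //; exact: measurable_funD.
  move=> t t0; rewrite normrM [`|expR _|]ger0_norm ?expR_ge0// ler_wpM2l
    ?expR_ge0//.
  by rewrite (le_trans (ler_normD _ _))// lerD ?s1// ger0_norm.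
- by move=> t; rewrite /= in_itv/= andbT => /(grid_sum_indic_bounds J l0
    d0)/andP[].
Qed.

(** Moving the distribution function by one cell costs the factor
    [exp (l * d)], since the weights of neighbouring cells have that ratio. This
    absorbs the difference between a monotone function and its
    right-continuous modification. *)
Lemma grid_sum_shift_le l d J F G : 0 <= l -> 0 <= d ->
  (forall x, G x <= 1) -> (forall x, 0 <= G x) ->
  (forall j, F (j%:R * d) <= G (j.+1%:R * d)) ->
  grid_sum l d J F <=
    expR (l * d) * (grid_sum l d J G + expR (- (l * (J%:R * d)))).
Proof.
move=> l0 d0 G1 G0 FG.
apply: (@le_trans _ _ (\sum_(j < J) grid_weight l d j * G (j.+1%:R * d))).
  by apply: ler_sum => j _; rewrite ler_wpM2l ?grid_weight_ge0.
have wE j : grid_weight l d j = expR (l * d) * grid_weight l d j.+1.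
  by rewrite /grid_weight mulrBr -!expR_gridS.
under eq_bigr do rewrite wE -mulrA.
rewrite -mulr_sumr ler_wpM2l ?expR_ge0//.
apply: (@le_trans _ _ (grid_sum l d J.+1 G)).
  by rewrite /grid_sum big_ord_recl/= lerDr mulr_ge0 ?grid_weight_ge0.
rewrite /grid_sum big_ord_recr/= lerD2l.
rewrite -[leRHS]mulr1 ler_pM ?grid_weight_ge0//.
by rewrite /grid_weight gerBl expR_ge0.
Qed.

End grid.

(** * Limits of Laplace transforms *)

Section continuity_theorem.
Variable R : realType.

Local Notation D := (`[0%R, +oo[%classic : set R).

(** Compactness of the unit interval, in its ultrafilter form. *)
Lemma ultra_cvg (U : set_system nat) (u : nat -> R) : UltraFilter U ->
  (forall n, 0 <= u n <= 1) -> exists x : R, u n @[n --> U] --> x.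
Proof.
move=> UU u01; have PU : ProperFilter U by exact: ultra_proper.
have fU : UltraFilter (u @ U).
  split; first exact: fmap_proper_filter.
  move=> H PH uH; apply/seteqP; split => // A HA.
  have [//|nA] := in_ultra_setVsetC (u @^-1` A) UU.
  have : H (A `&` ~` A) by apply: filterI => //; exact: uH.
  by rewrite setICr => /filter_not_empty.
have := @segment_compact R 0 1; rewrite compact_ultra => /(_ _ fU).
case; last by move=> x [_ ux]; exists x.
by apply: nearW => n /=; rewrite in_itv/=.
Qed.

(** A Markov-type bound: at [t >= x >= 1 / l] the function
    [1 - exp (- l t)] is at least [1 / 2]. *)
Lemma laplace_tail (mu : rprob R) l x : on_nonneg mu -> 0 < l -> l^-1 <= x ->
  1 - dist_fun mu x <= 2 * (1 - laplace mu l).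
Proof.
move=> muD l0 lx; set E := expR (- (l * x)).
have E2 : E <= 1 / 2.
  have lx1 : 1 <= l * x by rewrite -ler_pdivrMl// mulr1.
  rewrite /E expRN div1r lef_pV2 ?posrE ?expR_gt0//.
  by rewrite (le_trans _ (expR_ge1Dx _))//; lra.
have E0 : 0 <= E by exact: expR_ge0.
have /andP[F0 F1] := dist_fun_bounds mu x.
have Ic c : mu.-integrable D (EFin \o (fun=> c)).
  by apply: (@integrable_nonneg _ _ _ `|c|).
have I1 : mu.-integrable D (EFin \o \1_(`]-oo, x]%classic)).
  apply: (@integrable_nonneg _ _ _ 1) => // t _.
  by rewrite indicE normr_nat lern1 leq_b1.
have I1E : mu.-integrable D (EFin \o (fun t => (1 - E) * \1_(`]-oo, x]%classic)
    t)).
  apply: (@integrable_nonneg _ _ _ 1).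
    exact: measurable_funM.
  move=> t _; rewrite indicE normrM normr_nat ger0_norm; last by lra.
  by case: (_ \in _); rewrite ?mulr1 ?mulr0//; lra.
have : laplace mu l <= E + (1 - E) * dist_fun mu x.
  rewrite -Rintegral_half_line// -RintegralZl//.
  rewrite -[X in X + _](Rintegral_cst_nonneg _ muD) -RintegralD//.
  apply: le_Rintegral => //.
  - by apply: integrable_expRM; exact: ltW.
  - apply: (@integrable_nonneg _ _ _ 1).
      by apply: measurable_funD => //; exact: measurable_funM.
    move=> t _; rewrite indicE.
    by case: (_ \in _); rewrite ?mulr1 ?mulr0 ger0_norm; lra.
  - move=> t; rewrite /= in_itv/= andbT => t0; rewrite indicE.
    have [tx|xt] := leP t x.
      rewrite mem_set/= ?in_itv//= mulr1 subrKC.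
      by have /andP[] := expRM_bounds (ltW l0) t0.
    rewrite memNset/= ?in_itv/=; last by apply/negP; rewrite -ltNge.
    by rewrite mulr0 addr0 ler_expR lerN2 ler_wpM2l// ltW.
have : 0 <= (1 / 2 - E) * (1 - dist_fun mu x) by rewrite mulr_ge0 ?subr_ge0.
lra.
Qed.

Lemma on_nonneg_dist_fun0 (mu : rprob R) x : on_nonneg mu -> x < 0 ->
  dist_fun mu x = 0.
Proof.
move=> muD x0; suff : mu `]-oo, x]%classic = 0%E by rewrite /dist_fun => ->.
apply/eqP; rewrite eq_le measure_ge0 andbT -(on_nonnegC muD) le_measure ?inE//.
  exact: measurableC.
move=> t /=; rewrite !in_itv/= => tx; apply/negP; rewrite andbT -ltNge.
exact: le_lt_trans x0.
Qed.

Lemma dist_fun0_on_nonneg (mu : rprob R) :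
  (forall x, x < 0 -> dist_fun mu x = 0) -> on_nonneg mu.
Proof.
move=> mu0; rewrite /on_nonneg -(setCK `[0, +oo[%classic) probability_setC//;
  last first.
  exact: measurableC.
rewrite [X in (1 - X)%E](_ : _ = 0%E) ?sube0//.
have : mu.-negligible (\bigcup_n `]-oo, - (@harmonic R n)]%classic).
  apply: negligible_bigcup => n; apply/negligibleP => //.
  have h0 : - (@harmonic R n) < 0 by rewrite oppr_lt0 harmonic_gt0.
  have : mu `]-oo, - (@harmonic R n)]%classic = 0%E by rewrite -dist_funE mu0.
  exact.
move=> neg; apply/negligibleP; first exact: measurableC.
apply: negligibleS neg => t /=; rewrite in_itv/= andbT => /negP.
rewrite -ltNge => t0; exists (Num.truncn (- t)^-1) => //=.
rewrite in_itv/= lerNr /harmonic/= -[leRHS]invrK lef_pV2 ?posrE ?invr_gt0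
  ?oppr_gt0//.
by apply: ltW; exact: truncnS_gt.
Qed.

(** Along an ultrafilter all distribution functions converge at once, to a
    monotone [G] whose right-continuous modification [F] satisfies
    [G x <= F x <= G y] for [x < y]. No mass escapes to infinity because [L]
    tends to one at the origin. The transform of the resulting measure and
    [L] are both sandwiched between grid sums, and the gap closes for mesh
    [1 / (m + 1)] and [(m + 1)^2] cells. *)
Theorem laplace_limit (mus : nat -> rprob R) (L : R -> R) :
  (forall n, on_nonneg (mus n)) ->
  (forall l, 0 <= l -> laplace (mus n) l @[n --> \oo] --> L l) ->
  (forall e, 0 < e -> exists2 l, 0 < l & 1 - e < L l) ->
  exists2 mu : rprob R, on_nonneg mu & forall l, 0 <= l -> laplace mu l = L l.
Proof.
move=> musD muL L1.
have [U [UU ooU]] := ultraFilterLemma (@eventually_filter : ProperFilter \oo).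
have PU : ProperFilter U by exact: ultra_proper.
have LU l : 0 <= l -> laplace (mus n) l @[n --> U] --> L l.
  by move=> l0 A /(muL l l0); exact: ooU.
have /choice[G GU] : forall x, exists y : R, dist_fun (mus n) x @[n --> U] -->
    y.
  by move=> x; apply: ultra_cvg => // n; exact: dist_fun_bounds.
have Gnd x y : x <= y -> G x <= G y.
  move=> xy; apply: (ler_cvg_to (GU x) (GU y)).
  by apply: nearW => n; exact: dist_fun_le.
have cU (z : R) : (fun=> z) @ U --> z by exact: cvg_cst.
have G0 x : 0 <= G x.
  apply: (ler_cvg_to (cU 0) (GU x)); apply: nearW => n.
  by have /andP[] := dist_fun_bounds (mus n) x.
have G1 x : G x <= 1.
  apply: (ler_cvg_to (GU x) (cU 1)); apply: nearW => n.
  by have /andP[] := dist_fun_bounds (mus n) x.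
have Gneg x : x < 0 -> G x = 0.
  move=> x0; apply: (cvg_unique (@Rhausdorff R) (GU x)).
  by apply: cvg_near_cst; apply: nearW => n; exact: on_nonneg_dist_fun0.
have Gtail l x : 0 < l -> l^-1 <= x -> 1 - G x <= 2 * (1 - L l).
  move=> l0 lx.
  apply: (ler_cvg_to (cvgB (cU 1) (GU x)) (cvgM (cU 2) (cvgB (cU 1) (LU l (ltW
      l0))))).
  by apply: nearW => n; exact: laplace_tail.
pose F x := inf [set G y | y in [set y | x < y]].
have Flb x : has_lbound [set G y | y in [set y | x < y]].
  by exists 0 => _ [y _ <-].
have FG x y : x < y -> F x <= G y by move=> xy; apply: ge_inf => //; exists y.
have GF x y : x <= y -> G x <= F y.
  move=> xy; apply: lb_le_inf; first by exists (G (y + 1)), (y + 1) => //=;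
    rewrite ltrDl.
  by move=> _ [z /= yz <-]; apply: Gnd; rewrite (le_trans xy)// ltW.
have F0 x : 0 <= F x by rewrite (le_trans (G0 x))// GF.
have F1 x : F x <= 1 by rewrite (le_trans (FG x (x + 1) _))// ltrDl.
have Fnd : {homo F : x y / x <= y}.
  move=> x y; rewrite le_eqVlt => /predU1P[->//|xy].
  by rewrite (le_trans (FG _ _ xy))// GF.
have Fneg x : x < 0 -> F x = 0.
  move=> x0; apply/eqP; rewrite eq_le F0 andbT -(Gneg (x / 2)).
    by apply: FG; lra.
  by lra.
have Frc : right_continuous F.
  move=> x; apply/cvgrPdist_le => e e0.
  have [_ [y /= xy <-] Gy] : exists2 z, [set G y | y in [set y | x < y]] z & z
      < F x + e.
    apply: inf_adherent => //; split => //.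
    by exists (G (x + 1)), (x + 1) => //=; rewrite ltrDl.
  near=> z; have xz : x < z by near: z; exact: nbhs_right_gt.
  have zy : z < y by near: z; exact: nbhs_right_lt.
  rewrite distrC ger0_norm ?subr_ge0 ?Fnd ?(ltW xz)//.
  by rewrite lerBlDl (le_trans (FG _ _ zy))// ltW.
have FNy : F @ -oo --> (0 : R).
  apply: cvg_near_cst; near=> x; apply: Fneg.
  by near: x; exact: nbhs_ninfty_lt.
have Fy : F @ +oo --> (1 : R).
  apply/cvgrPdist_le => e e0; have [l l0 Ll] := L1 _ (divr_gt0 e0 (ltr0n R 2)).
  near=> x; rewrite ger0_norm ?subr_ge0//.
  have lx : l^-1 <= x by near: x; apply: nbhs_pinfty_ge; rewrite num_real.
  have := Gtail l x l0 lx; have := GF x x (lexx x); lra.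
have [mu muF] := probability_of_cdf Fnd Frc FNy Fy.
have massF : dist_fun mu = F by apply/funext => x; rewrite /dist_fun muF.
have muD : on_nonneg mu by apply: dist_fun0_on_nonneg; rewrite massF.
exists mu => // l; rewrite le_eqVlt => /predU1P[<-|l0].
  rewrite laplace0//; apply: (cvg_unique (@Rhausdorff R) _ (muL 0 (lexx 0))).
  by apply: cvg_near_cst; apply: nearW => n; rewrite laplace0.
have gridL d J : 0 <= d -> grid_sum l d J G <= L l <=
    expR (l * d) * (grid_sum l d J G + expR (- (l * (J%:R * d)))).
  move=> d0; have QU : grid_sum l d J (dist_fun (mus n)) @[n --> U] -->
      grid_sum l d J G.
    apply: cvg_big => [|i _]; first exact: add_continuous.
    by apply: cvgMr; exact: GU.
  have lb n := laplace_grid_bounds J (musD n) (ltW l0) d0.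
  apply/andP; split.
    apply: (ler_cvg_to QU (LU l (ltW l0))); apply: nearW => n.
    by have /andP[] := lb n.
  apply: (ler_cvg_to (LU l (ltW l0)) (cvgM (cU _) (cvgD QU (cU _)))).
  by apply: nearW => n; have /andP[] := lb n.
pose d m := @harmonic R m; pose J m := (m.+1 ^ 2)%N.
pose q m := expR (l * d m); pose r m := expR (- (l * ((J m)%:R * d m))).
have bounds m : L l <= q m * (laplace mu l + r m) /\
    laplace mu l <= q m * (q m * (L l + r m) + r m).
  have d0 : 0 <= d m by exact: harmonic_ge0.
  have dlt (j : nat) : j%:R * d m < j.+1%:R * d m.
    by rewrite ltr_pM2r ?ltr_nat// harmonic_gt0.
  have q0 : 0 <= q m by exact: expR_ge0.
  have /andP[GL LG] := gridL _ (J m) d0.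
  have := laplace_grid_bounds (J m) muD (ltW l0) d0.
  rewrite massF => /andP[Fmu muF'].
  have GQF := @grid_sum_le _ l (d m) (J m) G F (ltW l0) d0 (fun x => GF x x
      (lexx x)).
  have FQG := @grid_sum_shift_le _ l (d m) (J m) F G (ltW l0) d0 G1 G0
    (fun j => FG _ _ (dlt j)).
  split.
    by rewrite (le_trans LG)// ler_wpM2l// lerD2r (le_trans GQF).
  rewrite (le_trans muF')// ler_wpM2l// lerD2r (le_trans FQG)//.
  by rewrite ler_wpM2l// lerD2r.
have qcvg : q m @[m --> \oo] --> (1 : R).
  rewrite -(expR0 R) /q; apply: continuous_cvg; first exact: continuous_expR.
  rewrite -[in X in _ --> X](mulr0 l); apply: cvgMr; exact: cvg_harmonic.
have rcvg : r m @[m --> \oo] --> (0 : R).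
  have rE m : r m = expR (- l) ^+ m.+1.
    rewrite /r -expRM_natl /J /d /harmonic/= natrX expr2 mulfK ?pnatr_eq0//.
    by rewrite mulrC mulrN.
  under eq_fun do rewrite rE exprS.
  rewrite -(mulr0 (expR (- l))); apply: cvgMr; apply: cvg_expr.
  by rewrite ger0_norm ?expR_ge0// expR_lt1 oppr_lt0.
have c (z : R) : (fun=> z) @ \oo --> z by exact: cvg_cst.
apply/eqP; rewrite eq_le; apply/andP; split.
  have H : q m * (q m * (L l + r m) + r m) @[m --> \oo] -->
      1 * (1 * (L l + 0) + 0).
    by do 2 (apply: cvgM => //; apply: cvgD => //).
  rewrite !mul1r !addr0 in H; apply: (ler_cvg_to (c _) H).
  by apply: nearW => m; have [] := bounds m.
have H : q m * (laplace mu l + r m) @[m --> \oo] --> 1 * (laplace mu l + 0).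
  by apply: cvgM => //; apply: cvgD.
rewrite mul1r addr0 in H; apply: (ler_cvg_to (c _) H).
by apply: nearW => m; have [] := bounds m.
Unshelve. all: by end_near. Qed.

End continuity_theorem.

(** * Bounds on the Laplace transform *)

Section fortet_mourier.
Variable R : realType.
Implicit Types (mu nu : rprob R) (l x y d e : R).

Local Notation D := (`[0%R, +oo[%classic : set R).

Lemma lipschitz_measurable (f : R -> R) : 1.-lipschitz_D f -> measurable_fun D
    f.
Proof.
move=> fL; apply: subspace_continuous_measurable_fun => //.
apply/subspace_continuousP => x Dx; apply/cvgrPdist_lt => e e0.
exists e => //= y xy Dy; apply: le_lt_trans xy.
by have := fL (x, y); rewrite /= mul1r; apply.
Qed.

Lemma Rintegral_dist_le_dFM mu nu (f : R -> R) :
  on_nonneg mu -> on_nonneg nu ->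
  (forall x, 0 <= x -> -1 <= f x <= 1) -> 1.-lipschitz_D f ->
  `|\int[mu]_(x in D) f x - \int[nu]_(x in D) f x| <= dFM mu nu.
Proof.
move=> muD nuD f1 fL; apply: ub_le_sup; last by exists f.
exists 2 => _ [g [g1 gL] <-].
have g_le1 (mu' : rprob R) : on_nonneg mu' -> `|\int[mu']_(x in D) g x| <= 1.
  move=> mu'D; have := @Rintegral_dist _ mu' g (fun=> 0) 1 1 mu'D.
  rewrite Rintegral_cst_nonneg// subr0; apply => //.
  - exact: lipschitz_measurable.
  - by move=> x x0; rewrite ler_norml g1.
  - by move=> x x0; rewrite subr0 ler_norml g1.
rewrite (le_trans (ler_normB _ _))//.
by have := g_le1 _ muD; have := g_le1 _ nuD; lra.
Qed.

Lemma expRM_lipschitz l x y : 0 <= l -> 0 <= x -> 0 <= y ->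
  `|expR (- (l * x)) - expR (- (l * y))| <= l * `|x - y|.
Proof.
move=> l0; wlog xy : x y / x <= y.
  move=> H x0 y0; have [xy|yx] := leP x y; first exact: H.
  by rewrite distrC (distrC x); apply: H => //; exact: ltW.
move=> x0 y0; rewrite ger0_norm; last first.
  by rewrite subr_ge0 ler_expR lerN2 ler_wpM2l.
rewrite ler0_norm ?subr_le0// opprB.
have -> : expR (- (l * y)) = expR (- (l * x)) * expR (- (l * (y - x))).
  by rewrite -expRD; congr expR; ring.
have /andP[E0 E1] := expRM_bounds l0 x0.
have e1 := expR_ge1Dx (- (l * (y - x))).
have lyx : 0 <= l * (y - x) by rewrite mulr_ge0// subr_ge0.
rewrite -{1}(mulr1 (expR (- (l * x)))) -mulrBr.
apply: (@le_trans _ _ (expR (- (l * x)) * (l * (y - x)))).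
  by rewrite ler_wpM2l//; lra.
by rewrite ler_piMl.
Qed.

(** After division by [1 + l] the function [exp (- l x)] becomes an admissible
    test function. *)
Lemma laplace_dist_le_dFM mu nu l : on_nonneg mu -> on_nonneg nu -> 0 <= l ->
  `|laplace mu l - laplace nu l| <= (1 + l) * dFM mu nu.
Proof.
move=> muD nuD l0; have l1 : 0 < 1 + l by rewrite ltr_wpDr.
rewrite -ler_pdivrMl//.
pose f t := (1 + l)^-1 * expR (- (l * t)).
have fE (mu' : rprob R) : \int[mu']_(t in D) f t = (1 + l)^-1 * laplace mu' l.
  by rewrite RintegralZl//; exact: integrable_expRM.
rewrite -[X in X * _]ger0_norm ?invr_ge0 ?(ltW l1)// -normrM mulrBr -!fE.
apply: Rintegral_dist_le_dFM => //.
  move=> x x0; have /andP[E0 E1] := expRM_bounds l0 x0.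
  rewrite -ler_norml /f ger0_norm; last by rewrite mulr_ge0 ?invr_ge0 ?(ltW l1).
  by rewrite ler_pdivrMl// mulr1 (le_trans E1)// lerDl.
move=> [x y] /= []; rewrite !in_itv/= !andbT => x0 y0.
rewrite /f -mulrBr normrM ger0_norm ?invr_ge0 ?(ltW l1)// ler_pdivrMl// mul1r.
by rewrite (le_trans (expRM_lipschitz l0 x0 y0))// ler_wpM2r// lerDr.
Qed.

(** Integrate [1 - exp (- l t) <= l * d + 1_{t >= d}]. *)
Lemma laplace_ge_tail mu l d e : on_nonneg mu -> 0 <= l -> 0 <= d ->
  (mu `[d, +oo[%classic <= e%:E)%E -> 1 - l * d - e <= laplace mu l.
Proof.
move=> muD l0 d0 mude; rewrite -addrA -opprD lerBlDr -lerBlDl.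
have I1 : mu.-integrable D (EFin \o \1_(`[d, +oo[%classic)).
  apply: (@integrable_nonneg _ _ _ 1) => // t _.
  by rewrite indicE normr_nat lern1 leq_b1.
have Ic c : mu.-integrable D (EFin \o (fun=> c)).
  by apply: (@integrable_nonneg _ _ _ `|c|).
have Ie := integrable_expRM mu l0.
have I1e : mu.-integrable D (EFin \o (fun t => 1 - expR (- (l * t)))).
  apply: (@integrable_nonneg _ _ _ 1).
    by apply: measurable_funB => //; exact: measurable_expRM.
  move=> t t0; have /andP[? ?] := expRM_bounds l0 t0.
  by rewrite ger0_norm; lra.
have Ild : mu.-integrable D (EFin \o (fun t => l * d + \1_(`[d, +oo[%classic)
    t)).
  apply: (@integrable_nonneg _ _ _ (l * d + 1)); first exact: measurable_funD.
  move=> t _; rewrite ger0_norm ?addr_ge0 ?mulr_ge0// lerD2l.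
  by rewrite indicE lern1 leq_b1.
rewrite -[leLHS](_ : \int[mu]_(t in D) (1 - expR (- (l * t))) = _); last first.
  by rewrite RintegralB// Rintegral_cst_nonneg.
apply: (@le_trans _ _ (\int[mu]_(t in D) (l * d + \1_(`[d, +oo[%classic) t))).
  apply: le_Rintegral => // t; rewrite /= in_itv/= andbT => t0.
  have /andP[E0 E1] := expRM_bounds l0 t0; rewrite indicE.
  have [dt|td] := leP d t.
    rewrite mem_set/= ?in_itv/= ?dt//.
    have : 0 <= l * d by rewrite mulr_ge0.
    lra.
  rewrite memNset/= ?in_itv/= ?andbT; last by apply/negP; rewrite -ltNge.
  have := expR_ge1Dx (- (l * t)); have := ler_wpM2l l0 (ltW td); lra.
rewrite RintegralD// Rintegral_cst_nonneg// lerD2l.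
rewrite /Rintegral integral_indic// [X in fine X]on_nonnegI// -lee_fin fineK//.
by rewrite fin_num_measure.
Qed.

(** The exponential dominates the indicator of zero. *)
Lemma mass0_le_laplace mu l : on_nonneg mu -> 0 <= l ->
  (mu [set 0%R] <= (laplace mu l)%:E)%E.
Proof.
move=> muD l0; rewrite -(on_nonnegI muD)// -[leLHS]fineK ?fin_num_measure//;
  last first.
  exact: measurableI.
rewrite lee_fin; have -> : fine (mu ([set 0] `&` D)) = \int[mu]_(t in D)
  \1_[set (0:R)] t.
  by rewrite /Rintegral integral_indic.
apply: le_Rintegral => //.
- apply: (@integrable_nonneg _ _ _ 1) => // t _.
  by rewrite indicE normr_nat lern1 leq_b1.
- exact: integrable_expRM.
- move=> t _; rewrite indicE; have [->|t0] := eqVneq t 0.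
    by rewrite mem_set//= mulr0 oppr0 expR0.
  by rewrite memNset ?expR_ge0//=; exact/eqP.
Qed.

Lemma weak_cvg_laplace (mus : nat -> rprob R) mu l : 0 <= l ->
  weak_cvg mus mu -> laplace (mus n) l @[n --> \oo] --> laplace mu l.
Proof.
move=> l0; apply.
  apply: continuous_subspaceT => x.
  apply: (@continuous_comp _ _ _ (fun t => - (l * t)) expR).
    by apply: cvgN; apply: cvgMr; exact: cvg_id.
  exact: continuous_expR.
exists 1; split; first exact: num_real.
move=> y y1 x; rewrite /= in_itv/= andbT => x0.
have /andP[E0 E1] := expRM_bounds l0 x0.
by rewrite ger0_norm// (le_trans E1)// ltW.
Qed.

End fortet_mourier.

(** * The triangular array *)

Section convolution_triangle.
Variables (R : realType) (a : nat -> R).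
Hypothesis a01 : forall n, 0 < a n < 1.
Hypothesis a1 : a n @[n --> \oo] --> (1 : R).
Variable p : nat -> nat -> rprob R.
Hypothesis p_nonneg : forall n m, (0 < m)%N -> on_nonneg (p n m).

Definition exponent l n m := - ln (laplace (p n m) l).

Local Notation S l := (fun n k => psum (exponent l n) k).

Lemma exponent_ge0 l n m : 0 <= l -> 0 <= exponent l n m.
Proof. by move=> l0; rewrite oppr_ge0 ln_le0// laplace_le1. Qed.

Lemma conv_upto_nonneg n k : on_nonneg (conv_upto (p n) k).
Proof. by apply: on_nonneg_conv_upto => m; exact: p_nonneg. Qed.

Lemma laplace_conv_expR l n k : 0 <= l ->
  laplace (conv_upto (p n) k) l = expR (- psum (exponent l n) k).
Proof.
move=> l0; rewrite laplace_conv_upto//; last by move=> m; exact: p_nonneg.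
rewrite /psum -sumrN expR_sum; apply: eq_big_nat => m /andP[m0 _].
by rewrite opprK lnK// posrE laplace_gt0//; exact: p_nonneg.
Qed.

Lemma psum_exponent_ln l n k : 0 <= l ->
  psum (exponent l n) k = - ln (laplace (conv_upto (p n) k) l).
Proof. by move=> l0; rewrite laplace_conv_expR// expRK opprK. Qed.

Lemma rho_discounted_sum l n : 0 <= l ->
  discounted_sum (a n) (psum (exponent l n)) (laplace (rho_seq a01 p n) l).
Proof.
move=> l0 N; under eq_bigr do rewrite -laplace_conv_expR//.
by apply: laplace_geom_mixture_bounds => // m; exact: p_nonneg.
Qed.

Lemma ln_dist_le (x y : R) : 1 / 2 <= x -> 1 / 2 <= y ->
  `|- ln x - - ln y| <= 2 * `|x - y|.
Proof.
wlog xy : x y / x <= y.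
  move=> H x2 y2; have [xy|yx] := leP x y; first exact: H.
  by rewrite distrC (distrC x); apply: H => //; exact: ltW.
move=> x2 y2; have x0 : 0 < x by lra. have y0 : 0 < y by lra.
have lnxy : ln x <= ln y by rewrite ler_ln.
rewrite opprK [ler_RHS in _ <= ler_RHS](_ : _ = 2 * (y - x)); last first.
  by rewrite ler0_norm ?opprB// subr_le0.
rewrite addrC ger0_norm ?subr_ge0// -ln_div ?posrE//.
have -> : y / x = 1 + (y - x) / x by field; rewrite gt_eqF.
apply: (@le_trans _ _ ((y - x) / x)).
  by apply: le_ln1Dx; rewrite (@lt_le_trans _ _ 0)// divr_ge0 ?subr_ge0 ?(ltW
      x0).
rewrite mulrC ler_wpM2r ?subr_ge0// -[leRHS]invrK lef_pV2 ?posrE ?invr_gt0//.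
by rewrite -div1r.
Qed.

(** Infinitesimality keeps the transforms above [1 / 2], where the logarithm is
    Lipschitz with constant [2]; the Fortet-Mourier deviation from periodicity
    thereby controls that of the exponents. *)
Lemma condC_linear_rate l : 0 <= l -> condC a p ->
  exists2 c : nat -> R, (forall n, 0 <= c n) & linear_rate a (S l) c.
Proof.
move=> l0 [small [d [d0 ad near_per]]].
apply: (linear_rate_periodic a01 _ d0 ad) => [n m|T T0].
  exact: exponent_ge0.
have l4 : 0 < 4 * (1 + l) by rewrite mulr_gt0// ltr_wpDr.
(* If l * del <= 1 / 4 and the mass beyond del is at most 1 / 4, then the
   transform is at least 1 / 2. *)
pose del := (4 * (1 + l))^-1.
have del0 : 0 < del by rewrite invr_gt0.
have ldel : l * del <= 1 / 4.
  rewrite /del ler_pdivrMr//; lra.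
have half : \forall n \near \oo, forall m, (1 <= m <= nsteps (a n) T)%N ->
    1 / 2 <= laplace (p n m) l.
  have /fine_cvgP[fin_sup /cvgrPdist_lt/(_ (1 / 4))] := small T del T0 del0.
  have q4 : 0 < 1 / 4 :> R by rewrite divr_gt0.
  move=> /(_ q4) lt_sup; apply: filterS2 fin_sup lt_sup => n fin_sup lt_sup m
    mT.
  have : (p n m `[del, +oo[%classic <= (1 / 4)%:E)%E.
    apply: (@le_trans _ _ (ereal_sup [set p n m `[del, +oo[%classic | m in
      [set m | (1 <= m <= nsteps (a n) T)%N]])).
      by apply: ereal_sup_ubound; exists m.
    rewrite -[leLHS]fineK// lee_fin.
    move: lt_sup; rewrite sub0r normrN /= => lt_sup.
    exact: le_trans (ler_norm _) (ltW lt_sup).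
  have [m0 _] := andP mT.
  move=> /(laplace_ge_tail (p_nonneg n m0) l0 (ltW del0)); lra.
have dT : \forall n \near \oo, (d n <= nsteps (a n) T)%N.
  move/cvgrPdist_lt: ad => /(_ _ T0); apply: filterS => n.
  rewrite sub0r normrN => adT; have /andP[_ an1] := a01 n.
  apply: le_nsteps => //; rewrite mulrC; exact: le_trans (ler_norm _) (ltW adT).
apply: (@squeeze_cvgr _ _ _ _ (fun=> 0) (fun n => 2 * (1 + l) *
    (\sum_(1 <= m < (nsteps (a n) T).+1) dFM (p n m) (p n (mod_pos m (d n)))))).
- apply: filterS2 half dT => n half dT; apply/andP; split.
    exact: psum_ge0.
  rewrite /psum mulr_sumr !big_nat; apply: ler_sum => m /andP[m0 mT].
  have m'T : (1 <= mod_pos m (d n) <= nsteps (a n) T)%N.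
    rewrite /mod_pos; case: ifPn => [_|]; first by rewrite d0 dT.
    rewrite /dvdn -lt0n => ->/=; apply: leq_trans dT; apply: ltnW.
    by rewrite ltn_mod.
  have mT' : (1 <= m <= nsteps (a n) T)%N by rewrite m0 -ltnS.
  apply: (le_trans (ln_dist_le (half _ mT') (half _ m'T))).
  rewrite -mulrA ler_wpM2l//; apply: laplace_dist_le_dFM => //.
    exact: p_nonneg.
  by have /andP[m'0 _] := m'T; exact: p_nonneg.
- exact: cvg_cst.
- rewrite -[X in _ --> X](mulr0 (2 * (1 + l))); apply: cvgMr; exact: near_per.
Qed.

Lemma linear_growth_laplace l psi tau : 0 <= l -> 0 < tau ->
  linear_growth a (S l) psi ->
  laplace (conv_upto (p n) (nsteps (a n) tau)) l @[n --> \oo] -->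
    expR (- (tau * psi)).
Proof.
move=> l0 tau0 Sg; under eq_fun do rewrite laplace_conv_expR//.
apply: continuous_cvg; first exact: continuous_expR.
by apply: cvgN; exact: (linear_growth_cvg a01 a1 tau0 Sg).
Qed.

Lemma laplace_psum_cvg l k (q : R) : 0 <= l -> 0 < q ->
  laplace (conv_upto (p n) (k n)) l @[n --> \oo] --> q ->
  S l n (k n) @[n --> \oo] --> - ln q.
Proof.
move=> l0 q0 Lq; under eq_fun do rewrite psum_exponent_ln//.
apply: cvgN; apply: continuous_cvg => //; exact: continuous_ln.
Qed.

Lemma powR_expR_ln (x t : R) : 0 < x -> x `^ t = expR (- (t * - ln x)).
Proof. by move=> x0; rewrite mulrN opprK /powR gt_eqF. Qed.

(** Convergence of transforms to the powers of the transform of [nu] is all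
    that (A) needs: the limit theorem produces the powers, and the power
    [1 / k] is a [k]-th convolution root of [nu] by uniqueness. *)
Lemma condA_for_laplace (nu : rprob R) : on_nonneg nu -> nu [set 0] = 0%E ->
  (forall l tau : R, 0 <= l -> 0 < tau ->
    laplace (conv_upto (p n) (nsteps (a n) tau)) l @[n --> \oo] -->
      laplace nu l `^ tau) ->
  condA_for a p nu.
Proof.
move=> nuD nu0 Lnu.
have powers tau : 0 < tau -> exists2 mu : rprob R, is_conv_power nu tau mu &
    weak_cvg (fun n => conv_upto (p n) (nsteps (a n) tau)) mu.
  move=> tau0.
  have [||e e0|mu muD muL] := @laplace_limit R
    (fun n => conv_upto (p n) (nsteps (a n) tau))
    (fun l => laplace nu l `^ tau).
  - by move=> n; exact: conv_upto_nonneg.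
  - by move=> l l0; exact: Lnu.
  (* The power tau of exp (- e / tau) is exp (- e), which is at least 1 - e. *)
  - have q1 : expR (- (e / tau)) < 1.
      by rewrite expR_lt1 oppr_lt0 divr_gt0.
    have [|l l0 Ll] := @laplace_near0 _ nu (1 - expR (- (e / tau))) nuD.
      by rewrite subr_gt0.
    exists l => //; rewrite subKr in Ll.
    apply: (@le_lt_trans _ _ (expR (- e))); first by rewrite expR_ge1Dx.
    have nu_gt0 := laplace_gt0 nuD (ltW l0).
    rewrite powR_expR_ln// ltr_expR ltrN2 -ltr_pdivlMl//.
    rewrite ltrNl mulrC -ltr_expR lnK ?posrE//.
  - exists mu; first by split.
    apply: laplace_weak_cvg => //.
      by move=> n; exact: conv_upto_nonneg.
    by move=> l l0; rewrite muL//; exact: Lnu.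
split => // k k0; have [|mu [muD muL] _] := powers k%:R^-1.
  by rewrite invr_gt0 ltr0n.
exists mu => //; apply: laplace_inj => //.
  by apply: on_nonneg_conv_upto.
move=> l l0; rewrite laplace_conv_upto// prodr_const_nat subn1/= muL//.
rewrite -powR_mulrn ?powR_ge0// -powRrM mulVf ?pnatr_eq0 -?lt0n//.
by rewrite powRr1// laplace_ge0.
Qed.

Lemma condB2_condA : condB2 a p -> condC a p -> condA a p.
Proof.
move=> [nu [nuD nu0 nucvg]] C; exists nu; apply: condA_for_laplace => // l tau
  l0 tau0.
have nu_gt0 := laplace_gt0 nuD l0.
rewrite powR_expR_ln//; apply: linear_growth_laplace => //.
have [c c0 Sc] := condC_linear_rate l0 C.
apply: (growth_of_nsteps1 a01 a1 c0 _ Sc).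
  by rewrite oppr_ge0 ln_le0// laplace_le1.
by apply: laplace_psum_cvg => //; exact: weak_cvg_laplace nucvg.
Qed.

Lemma condB1_growth (rho : rprob R) l : 0 <= l -> condB1_for a01 p rho ->
  condC a p -> linear_growth a (S l) ((laplace rho l)^-1 - 1).
Proof.
move=> l0 [rhoD rho0 rhocvg] C; have [c c0 Sc] := condC_linear_rate l0 C.
apply: (growth_of_discounted_sum a01 a1 c0 _ Sc).
- by rewrite laplace_gt0// laplace_le1.
- by move=> n; exact: rho_discounted_sum.
- exact: weak_cvg_laplace rhocvg.
Qed.

(** The measure [nu] is the limit at time one. Its transform is at most that of
    [rho], because [exp (- x) <= 1 / (1 + x)] at [x = 1 / laplace rho l - 1], so
    the absence of an atom at zero is inherited from [rho]. *)
Lemma condB1_condA : condB1 a01 p -> condC a p -> condA a p.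
Proof.
move=> [rho B1] C; have [rhoD rho0 _] := B1.
have [||e e0|nu nuD nuL] := @laplace_limit R
    (fun n => conv_upto (p n) (nsteps (a n) 1))
    (fun l => expR (- (1 * ((laplace rho l)^-1 - 1)))).
- by move=> n; exact: conv_upto_nonneg.
- move=> l l0; apply: linear_growth_laplace => //; exact: condB1_growth.
(* A transform of rho above 1 / (1 + e) makes the exponent of the limit
   smaller than e. *)
- have e1 : 0 < 1 + e by rewrite ltr_wpDr// ltW.
  have [|l l0 Ll] := @laplace_near0 _ rho (1 - (1 + e)^-1) rhoD.
    by rewrite subr_gt0 invf_lt1// ltrDl.
  exists l => //; rewrite subKr in Ll.
  apply: (lt_le_trans _ (expR_ge1Dx _)).
  have : (laplace rho l)^-1 < 1 + e.
    by rewrite -[ltRHS]invrK ltf_pV2 ?posrE ?invr_gt0// laplace_gt0// ltW.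
  lra.
exists nu; apply: condA_for_laplace => //.
  apply/eqP; rewrite eq_le measure_ge0 andbT; apply/lee_addgt0Pr => e e0.
  have [l l0 Ll] := laplace_infty rho0 e0.
  rewrite add0e (le_trans (mass0_le_laplace nuD l0))// lee_fin nuL//.
  apply: (le_trans _ (ltW Ll)).
  have rho_gt0 := laplace_gt0 rhoD l0.
  rewrite mul1r expRN -[leRHS]invrK lef_pV2 ?posrE ?expR_gt0 ?invr_gt0//.
  by rewrite (le_trans _ (expR_ge1Dx _))// addrC subrK.
move=> l tau l0 tau0; rewrite powR_expR_ln ?laplace_gt0// nuL// expRK opprK
  mul1r.
by apply: linear_growth_laplace => //; exact: condB1_growth.
Qed.

(** Periodicity is replaced by monotonicity: (A) gives the limit of the
    exponents at every time, which is enough for their linear growth. *)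
Lemma condB1_condA_laplace (rho nu : rprob R) l : condB1_for a01 p rho ->
  condA_for a p nu -> 0 <= l -> laplace rho l = (1 - ln (laplace nu l))^-1.
Proof.
move=> [_ _ rhocvg] [nuD _ _ powers] l0.
have nu_gt0 := laplace_gt0 nuD l0.
have psi0 : 0 <= - ln (laplace nu l) by rewrite oppr_ge0 ln_le0// laplace_le1.
apply: (cvg_unique (@Rhausdorff R) (weak_cvg_laplace l0 rhocvg)).
apply: (discounted_sum_growth_cvg a01 a1 psi0 (S := S l)); last first.
  by move=> n; exact: rho_discounted_sum.
apply: pointwise_linear_growth => //.
- by move=> n; exact: psum0.
- by move=> n; apply: psum_le => m; exact: exponent_ge0.
move=> tau tau0; have [nutau [_ nutauL] nutau_cvg] := powers tau tau0.
have -> : tau * - ln (laplace nu l) = - ln (laplace nutau l).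
  by rewrite nutauL// powR_expR_ln// expRK opprK.
apply: laplace_psum_cvg => //; first by rewrite nutauL// powR_gt0.
exact: weak_cvg_laplace nutau_cvg.
Qed.

End convolution_triangle.

Unset Implicit Arguments.

Theorem proposition2p5 (R : realType) (a : nat -> R)
    (a01 : forall n, 0 < a n < 1)
    (a_nd : nondecreasing_seq a)
    (a_cvg : a n @[n --> \oo] --> (1 : R))
    (p : nat -> nat -> rprob R)
    (p_pos : forall n m, (0 < m)%N -> on_pos (p n m)) :
  [/\ condB1 a01 p -> condC a p -> condA a p,
      condB2 a p -> condC a p -> condA a p &
      forall rho nu : rprob R, condB1_for a01 p rho -> condA_for a p nu ->
        forall l : R, 0 <= l -> laplace rho l = (1 - ln (laplace nu l))^-1].
Proof.
have p_nonneg n m : (0 < m)%N -> on_nonneg (p n m).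
  by move=> m0; apply: on_pos_nonneg; exact: p_pos.
split; [exact: condB1_condA|exact: condB2_condA|].
by move=> rho nu B1 A l l0; exact: condB1_condA_laplace B1 A l0.
Qed.
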